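(* Let $n\geq 3$ and let $F$ be an almost regular spherically symmetric Finsler metric on a domain $\Omega\subseteq\mathbb{R}^n$. Write $r=|x|$, $u=|y|$, $s=\frac{\langle x,y\rangle}{|y|}$. If $F$ is a Landsberg metric, then either (1) $F$ is Berwaldian, or (2) there exist smooth functions $c_1,c_2,c_3$ of $r$ such that \[F=u\exp\left(\int \frac{(c_1+2c_3)r^2s+2c_2\sqrt{r^2-s^2}}{r^2+(c_1+2c_3)r^2s^2-2c_3r^4+2c_2s\sqrt{r^2-s^2}}\,ds\right).\]
   Context: Here $\langle\cdot,\cdot\rangle$ and $|\cdot|$ are the standard Euclidean inner product and norm on $\mathbb{R}^n$, $x\in\Omega$, and $y\in T_x\Omega\cong\mathbb{R}^n$ is a nonzero tangent vector. A Finsler metric $F=F(x,y)$ on a domain $\Omega\subseteq\mathbb{R}^n$ is called spherically symmetric if it is invariant under all rotations of $\mathbb{R}^n$; then $F=u\,\phi(r,s)$ for a positive function $\phi$ of two variables. The metric tensor is $g_{ij}=\frac12\frac{\partial^2F^2}{\partial y^i\partial y^j}$, with inverse $g^{ij}$. A function $F=|y|\phi(|x|,\frac{\langle x,y\rangle}{|y|})$ is called an almost regular spherically symmetric Finsler metric if $F(x,y)>0$ and the matrix $(g_{ij}(x,y))$ is positive definite for all $y\in T_x\Omega$ with $\langle x,y\rangle<|x||y|$; $F$ may be singular for $y=kx$, i.e. in the radial directions. The geodesic spray coefficients are $G^i=\frac14 g^{il}\{(F^2)_{x^ky^l}y^k-(F^2)_{x^l}\}$ (summation convention). The Berwald curvature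 is $B^i_{\ jkl}=\frac{\partial^3G^i}{\partial y^j\partial y^k\partial y^l}$, and $F$ is Berwald (Berwaldian) if $B^i_{\ jkl}=0$. The Landsberg curvature is $L_{jkl}=-\frac12FF_{y^i}\frac{\partial^3G^i}{\partial y^j\partial y^k\partial y^l}$, and $F$ is a Landsberg metric if $L_{jkl}=0$ (wherever these are defined). The integral in (2) is an indefinite integral (antiderivative) in the variable $s$ for fixed $r$, hence determined up to an additive function of $r$; the claim is that the equality holds for some choice of antiderivative. *)

(* Defs.v *)
From HB Require Import structures.
From mathcomp Require Import all_boot all_order all_algebra.
From mathcomp Require Import all_classical all_reals all_analysis.

Set Implicit Arguments.
Unset Strict Implicit.
Unset Printing Implicit Defensive.

Import Order.TTheory GRing.Theory Num.Theory.
Import numFieldNormedType.Exports.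

Local Open Scope classical_set_scope.
Local Open Scope ring_scope.

(* C^oo on an open set A: every iterated directional derivative (the empty
   iteration being f itself) exists and is continuous at every point of A. *)
Definition smooth_on (R : realType) (V : normedModType R) (A : set V)
    (f : V -> R) : Prop :=
  forall (vs : seq V) (x : V), A x ->
    let g := foldr (fun v h => 'D_v h) f vs in
    {for x, continuous g} /\ forall v, derivable g x v.

Section Finsler.
Variables (R : realType) (n : nat).
Implicit Types (x y : 'rV[R]_n) (i j k l : 'I_n) (Omega : set 'rV[R]_n).
Implicit Types f F : 'rV[R]_n -> 'rV[R]_n -> R.

Definition is_domain Omega : Prop :=
  [/\ open Omega, connected Omega & Omega !=set0].

Definition dot x y : R := \sum_i x 0 i * y 0 i.

(* The Euclidean norm; the library norm of 'rV[R]_n is the sup norm (which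
   induces the same topology). *)
Definition enorm x : R := Num.sqrt (dot x x).

(* y is not a multiple of x (equality case of Cauchy-Schwarz); in particular
   x and y are nonzero. *)
Definition nonradial x y : Prop := `|dot x y| < enorm x * enorm y.

Definition partial_x i f x y : R := 'D_(delta_mx 0 i) (fun x' => f x' y) x.
Definition partial_y i f x y : R := 'D_(delta_mx 0 i) (f x) y.

Definition sqF F x y : R := F x y ^+ 2.

Definition metric_tensor F x y : 'M[R]_n :=
  \matrix_(i, j) (2^-1 * partial_y i (partial_y j (sqF F)) x y).

Definition posdef (M : 'M[R]_n) : Prop :=
  forall v : 'rV[R]_n, v != 0 -> 0 < (v *m M *m v^T) 0 0.

Definition spray F i x y : R :=
  4^-1 * \sum_l invmx (metric_tensor F x y) i l *
    ((\sum_k partial_y l (partial_x k (sqF F)) x y * y 0 k)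
     - partial_x l (sqF F) x y).

Definition berwald_curvature F i j k l x y : R :=
  partial_y j (partial_y k (partial_y l (spray F i))) x y.

Definition landsberg_curvature F j k l x y : R :=
  - 2^-1 * F x y *
    \sum_i partial_y i F x y * berwald_curvature F i j k l x y.

Definition spherically_symmetric Omega F : Prop :=
  exists phi : R -> R -> R, forall x y, Omega x -> y != 0 ->
    F x y = enorm y * phi (enorm x) (dot x y / enorm y).

(* F may be singular in both radial directions y = k x, whatever the sign of
   k, so regularity is required only where |<x,y>| < |x||y|.  This excludes
   every y when x = 0. *)
Definition almost_regular Omega F : Prop :=
  smooth_on [set p : 'rV[R]_n * 'rV[R]_n | Omega p.1 /\ nonradial p.1 p.2]
    (fun p => F p.1 p.2) /\
  (forall x y, Omega x -> nonradial x y ->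
     0 < F x y /\ posdef (metric_tensor F x y)).

Definition is_berwald Omega F : Prop :=
  forall x y, Omega x -> nonradial x y ->
    forall i j k l, berwald_curvature F i j k l x y = 0.

Definition is_landsberg Omega F : Prop :=
  forall x y, Omega x -> nonradial x y ->
    forall j k l, landsberg_curvature F j k l x y = 0.

Definition radii Omega : set R :=
  [set r | exists x, [/\ Omega x, x != 0 & enorm x = r]].

End Finsler.

(* Main.v *)
Require Import Defs.
From HB Require Import structures.
From mathcomp Require Import all_boot all_order all_algebra.
From mathcomp Require Import all_classical all_reals all_analysis.
From mathcomp Require Import ring lra.
Import Order.TTheory GRing.Theory Num.Theory.
Import numFieldNormedType.Exports.
Local Open Scope classical_set_scope.
Local Open Scope ring_scope.

(** Let [x = r e] with [e] a unit vector, split [y = p e + q w] with [w] a unit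
vector orthogonal to [e] and [q > 0], and put [m = p / q].  Then
[F = q H(r, m)], and the spray is [q al(m) (y - p e) + q^2 be(m) e].  With
[' = d/dm] and [tau = H' / (H - m H')], the Landsberg equations contracted with
[e, e, e] and with [v, v, e], where [v] is orthogonal to [x] and [y], read
[tau be''' + al''' = 0] and [tau (be' - m be'') = m al''].  Horizontal constancy
of [F] gives [tau (1/r - 2 be + m be') = m/r + 2 al - m al'].  Differentiating
these three relations forces [be' = m be''] and [al'' = 0], because [tau' > 0];
hence [tau'' (1/r - 2 be(0)) = 0].  If the second factor vanishes, [al(0) = 0] and
the spray is quadratic in [y].  Otherwise [tau(r, .)] is affine in [m], which is the
formula in (2).

The alternative holds at every single radius; to make it global, note that the
shape of [al] and [be] turns horizontal constancy into the transport equation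
[H_r = a(r) H + c(r) m H'].  For [n(r) = H''(r, 0) / H(r, 0) > 0] it yields
[n' = 2 c n], so [H(r, mu / sqrt (n r)) / H(r, 0)] is independent of [r], and
affinity of [tau] at one radius propagates to all of them. *)

Set Implicit Arguments.
Unset Strict Implicit.

(** * Directional derivatives and smoothness *)

(** Nothing is assumed about the regularity of [phi], and [F] is smooth only off the radial
    directions, so the analysis is carried by H(r, m) = F(r e, m e + w). The slope m runs over all
    of R, whereas s = r m / sqrt (1 + m^2) is confined to |s| < r; at a fixed radius every function
    is therefore smooth on the whole line and only r needs a domain. Positivity of the metric
    becomes H > 0, H - m H' > 0 and H'' > 0; since tau' = H H'' / (H - m H')^2, this is the source
    of tau' > 0. The dimension n >= 3 provides the vector v. The three relations give their
    conclusions only away from m = 0; that point is recovered by differentiating an identity of the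
    shape m f(m) = 0. The coefficients a(r) and c(r) of the transport equation are found at each
    radius separately, with no control on how they vary with r. Hence no equation in r is
    integrated: the propagation rests on a quotient from which both cancel. *)

Section DeriveRules.
Variables (R : realType) (V : normedModType R).
Implicit Types (f g : V -> R) (x v : V).

(** Passing to the line through [x] makes the one-variable chain rule available to functions that
    merely have directional derivatives. *)
Lemma is_derive_line f x v l :
  is_derive x v f l <-> is_derive (0 : R) 1 (fun h : R => f (h *: v + x)) l.
Proof.
have E : 'D_1 (fun h : R => f (h *: v + x)) 0 = 'D_v f x.
  rewrite /derive; congr (lim (_ @ 0^')); rewrite funeqE => h /=.
  by rewrite addr0 scale0r add0r [_%:A]mulr1.
split=> -[df dl]; apply: DeriveDef.
- exact: (proj1 (derivable1P f x v) df).
- by rewrite E.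
- exact: (proj2 (derivable1P f x v) df).
- by rewrite -E.
Qed.

Lemma drv_add f g x v a b : is_derive x v f a -> is_derive x v g b ->
  is_derive x v (fun z => f z + g z) (a + b).
Proof. by move=> *; apply: is_deriveD. Qed.

Lemma drv_opp f x v a : is_derive x v f a -> is_derive x v (fun z => - f z) (- a).
Proof. by move=> *; apply: is_deriveN. Qed.

Lemma drv_mul f g x v a b : is_derive x v f a -> is_derive x v g b ->
  is_derive x v (fun z => f z * g z) (a * g x + f x * b).
Proof.
move=> df dg.
have -> : a * g x + f x * b = f x *: b + g x *: a.
  by rewrite /GRing.scale /= addrC [g x * a]mulrC.
exact: (@is_deriveM _ _ f g x v a b df dg).
Qed.

Lemma drv_cst x v (c : R) : is_derive x v (fun=> c) 0.
Proof. exact: is_derive_cst. Qed.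

Lemma drv_exp f n x v a : is_derive x v f a ->
  is_derive x v (fun z => f z ^+ n) (n%:R * f x ^+ n.-1 * a).
Proof. by move=> df; have := @is_deriveX _ _ f n x v a df; rewrite exprfctE. Qed.

Lemma drv_comp (h : R -> R) f x v a b :
  is_derive (f x) 1 h b -> is_derive x v f a ->
  is_derive x v (fun z => h (f z)) (b * a).
Proof.
move=> dh /is_derive_line df; apply/is_derive_line.
apply: (@is_derive1_comp _ h (fun t : R => f (t *: v + x)) 0 b a) => //.
by rewrite scale0r add0r.
Qed.

Lemma drv_inv f x v a : f x != 0 -> is_derive x v f a ->
  is_derive x v (fun z => (f z)^-1) (- (f x) ^- 2 * a).
Proof.
move=> f0 [df <-]; apply: DeriveDef; first exact: derivableV.
exact: deriveV.
Qed.

Lemma drv_sqrt f x v a : 0 < f x -> is_derive x v f a ->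
  is_derive x v (fun z => Num.sqrt (f z)) ((2 * Num.sqrt (f x))^-1 * a).
Proof. by move=> f0 df; apply: drv_comp => //; exact: is_derive1_sqrt. Qed.

Lemma drv_eq f x v a b : is_derive x v f a -> a = b -> is_derive x v f b.
Proof. by move=> ? <-. Qed.

End DeriveRules.

Lemma drv_id (R : realType) (x v : R) : is_derive x v (fun z => z) v.
Proof. exact: is_derive_id. Qed.

(* [is_derive] is a class: plain [apply] would let instance resolution choose
   the derivative. *)
Ltac drv := first
 [ eassumption | notypeclasses refine (drv_cst _ _ _) | notypeclasses refine (drv_id _ _)
 | notypeclasses refine (drv_add _ _); drv
 | notypeclasses refine (drv_opp _); drv
 | notypeclasses refine (drv_mul _ _); drv
 | notypeclasses refine (drv_exp _ _); drv
 | notypeclasses refine (drv_inv _ _); [ | drv ]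
 | notypeclasses refine (drv_sqrt _ _); [ | drv ]
 | match goal with H : _ |- _ => notypeclasses refine (H _) end
 | match goal with H : forall m, is_derive _ _ ?h _ |- is_derive _ _ (fun z => ?h _) _ =>
     notypeclasses refine (drv_comp (H _) _); drv end
 | idtac ].

Ltac derive_by t := notypeclasses refine (drv_eq _ _); [ drv | cbv beta; t ].

Section AffineSubstitution.
Variables (R : realType) (U V : normedModType R) (l : {linear U -> V}) (c : V).

Lemma derive_affine (f : V -> R) (u : U) :
  'D_u (fun z => f (l z + c)) = (fun z => 'D_(l u) f (l z + c)).
Proof.
apply/funext => z; rewrite /derive; congr (lim (_ @ 0^')); apply/funext => h /=.
by rewrite (linearD l) (linearZZ l) addrA.
Qed.

Lemma derivable_affine (f : V -> R) (u z : U) :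
  derivable f (l z + c) (l u) -> derivable (fun z => f (l z + c)) z u.
Proof.
rewrite /derivable => H; set g := (X in cvg (X @ _)).
rewrite (_ : g = fun h => h^-1 *: ((f \o shift (l z + c)) (h *: l u) - f (l z + c))) //.
by apply/funext => h; rewrite /g /= (linearD l) (linearZZ l) addrA.
Qed.

Lemma foldr_derive_affine (f : V -> R) (us : seq U) :
  foldr (fun u h => 'D_u h) (fun z => f (l z + c)) us =
  (fun z => foldr (fun v h => 'D_v h) f (map l us) (l z + c)).
Proof. by elim: us => //= u us ->; rewrite derive_affine. Qed.

End AffineSubstitution.

Section SmoothOn.
Variables (R : realType) (V : normedModType R).
Implicit Types (A : set V) (f g : V -> R).

Lemma smooth_on_derive A f v : smooth_on A f -> smooth_on A ('D_v f).
Proof. by move=> sf vs x Ax; rewrite -(foldr_rcons (fun v h => 'D_v h)); exact: sf. Qed.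

Lemma smooth_on_continuous A f x : smooth_on A f -> A x -> {for x, continuous f}.
Proof. by move=> sf Ax; have [] := sf [::] x Ax. Qed.

Lemma smooth_on_derivable A f x v : smooth_on A f -> A x -> derivable f x v.
Proof. by move=> sf Ax; have [_ ] := sf [::] x Ax; exact. Qed.

Lemma smooth_on_is_derive A f x v : smooth_on A f -> A x -> is_derive x v f ('D_v f x).
Proof. by move=> sf Ax; apply: derivableP; exact: smooth_on_derivable sf Ax. Qed.

(** [smooth_on] is checked point by point. This serves [smooth_profile], whose frame depends on the
    point. *)
Lemma smooth_on_local A f :
  (forall x, A x -> exists2 B, B x & smooth_on B f) -> smooth_on A f.
Proof. by move=> h vs x /h [B Bx]; exact. Qed.

Lemma eq_derive_on A f g v : open A -> {in A, f =1 g} -> {in A, 'D_v f =1 'D_v g}.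
Proof.
move=> oA fg x /set_mem Ax; apply: near_eq_derive.
by near=> z; apply: fg; rewrite inE; near: z; exact: open_nbhs_nbhs.
Unshelve. all: by end_near. Qed.

Lemma eq_smooth_on A f g : open A -> {in A, f =1 g} -> smooth_on A f -> smooth_on A g.
Proof.
move=> oA fg sf vs.
have: {in A, foldr (fun v h => 'D_v h) f vs =1 foldr (fun v h => 'D_v h) g vs}.
  by elim: vs => [|v vs IH] //=; exact: eq_derive_on.
set F := foldr _ f vs; set G := foldr _ g vs => FG x Ax.
have [cF dF] : F @ x --> F x /\ forall v, derivable F x v := sf vs x Ax.
have nFG : \near x, F x = G x.
  by near=> z; apply: FG; rewrite inE; near: z; exact: open_nbhs_nbhs.
split=> [|v]; last exact: near_eq_derivable (dF v).
have FGx : F x = G x by exact: nbhs_singleton nFG.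
change (G @ x --> G x); move: cF; rewrite FGx; apply: cvg_trans.
exact: near_eq_cvg.
Unshelve. all: by end_near. Qed.

End SmoothOn.

(** Iterated derivatives of the pullback along [us] are iterated derivatives of [f] along the images
    [l u], so no chain rule is involved. *)
Lemma smooth_on_affine (R : realType) (U V : normedModType R) (l : {linear U -> V}) (c : V)
    (A : set V) (B : set U) (f : V -> R) :
  continuous l -> (forall z, B z -> A (l z + c)) -> smooth_on A f ->
  smooth_on B (fun z => f (l z + c)).
Proof.
move=> cl BA sf us z Bz /=; rewrite foldr_derive_affine.
have [cf df] := sf (map l us) _ (BA _ Bz); split=> [|u]; last exact: derivable_affine.
apply: (@continuous_comp _ _ _ (fun z => l z + c)) => //.
by apply: continuousD => //; [exact: cl|exact: cvg_cst].
Qed.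

(** The difference [g - f] vanishes near [x], so it is negligible against the increment and has
    differential 0. *)
Lemma near_eq_differentiable (R : numFieldType) (V W : normedModType R) (f g : V -> W) (x : V) :
  (\near x, f x = g x) -> differentiable f x -> differentiable g x.
Proof.
move=> fg df; have -> : g = f + (g - f) by rewrite addrC subrK.
apply: differentiableD => //; set k := g - f.
have kx : k x = 0 by apply/eqP; rewrite subr_eq0; apply/eqP/esym/(nbhs_singleton fg).
have kE : k \o shift x = cst (k x) + (\0 : {linear V -> W}) +o_ 0 id.
  apply/eqaddoP => e e0 /=; near=> z.
  rewrite kx !fctE /= !addr0 oppr0 addr0.
  suff -> : k (z + x) = 0 by rewrite normr0 mulr_ge0 // ltW.
  apply/eqP; rewrite subr_eq0; apply/eqP/esym; near: z.
  suff cz : (z + x) @[z --> (0 : V)] --> x by exact: cz _ fg.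
  by rewrite -[X in _ --> X]add0r; apply: cvgD; [exact: cvg_id|exact: cvg_cst].
apply/diff_locallyP; rewrite (diff_unique _ kE); last exact: cst_continuous.
by split; first exact: cst_continuous.
Unshelve. all: by end_near. Qed.

(** * Functions that are k times Fréchet differentiable *)

Section Ck.
Variable R : realType.

(** Fréchet differentiability at every level makes the sum, product and chain rules provable by
    induction on [k]. Continuity of the last derivatives is not recorded; it comes back when [Ck]
    holds for all [k], which yields [smooth_on]. *)
Fixpoint Ck (V : normedModType R) (k : nat) (A : set V) (f : V -> R) : Prop :=
  if k is k'.+1 then (forall x, A x -> differentiable f x) /\ forall v, Ck k' A ('D_v f)
  else True.

Variable V : normedModType R.
Implicit Types (A : set V) (f g : V -> R).

Lemma CkS k A f : Ck k.+1 A f -> Ck k A f.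
Proof. by elim: k f => [//|k IH] f /= [df Df]; split=> // v; apply: IH. Qed.

Lemma Ck_derive k A f v : Ck k.+1 A f -> Ck k A ('D_v f).
Proof. by move=> /= [_]; exact. Qed.

Lemma Ck_differentiable k A f x : Ck k.+1 A f -> A x -> differentiable f x.
Proof. by move=> /= [+ _]; exact. Qed.

Lemma Ck_is_derive k A f x v : Ck k.+1 A f -> A x -> is_derive x v f ('D_v f x).
Proof. by move=> Cf Ax; apply/derivableP/diff_derivable/(Ck_differentiable Cf). Qed.

Lemma eq_Ck k A f g : open A -> {in A, f =1 g} -> Ck k A f -> Ck k A g.
Proof.
move=> oA; elim: k f g => [//|k IH] f g fg /= [df Df]; split=> [x Ax|v].
  apply: near_eq_differentiable (df x Ax).
  by near=> z; apply: fg; rewrite inE; near: z; exact: open_nbhs_nbhs.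
by apply: IH (Df v); exact: eq_derive_on.
Unshelve. all: by end_near. Qed.

Lemma Ck_cst k A c : Ck k A (fun=> c).
Proof.
elim: k c => [//|k IH] c; split=> [x _|v]; first exact: differentiable_cst.
rewrite (_ : 'D_v _ = fun=> 0); first exact: IH.
by apply/funext => x; rewrite derive_cst.
Qed.

Lemma Ck_add k A f g : open A -> Ck k A f -> Ck k A g -> Ck k A (fun x => f x + g x).
Proof.
move=> oA; elim: k f g => [//|k IH] f g Cf Cg; split=> [x Ax|v].
  apply: (@differentiableD _ _ _ f g); [exact: Ck_differentiable Cf Ax|exact: Ck_differentiable
      Cg Ax].
apply: (eq_Ck (f := fun x => 'D_v f x + 'D_v g x)) => // [x /set_mem Ax|].
  have df := Ck_is_derive v Cf Ax; have dg := Ck_is_derive v Cg Ax.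
  by apply/esym/derive_val; apply: drv_add.
by apply: IH; exact: Ck_derive.
Qed.

Lemma Ck_mul k A f g : open A -> Ck k A f -> Ck k A g -> Ck k A (fun x => f x * g x).
Proof.
move=> oA; elim: k f g => [//|k IH] f g Cf Cg; split=> [x Ax|v].
  apply: (@differentiableM _ _ f g); [exact: Ck_differentiable Cf Ax|exact: Ck_differentiable Cg
      Ax].
apply: (eq_Ck (f := fun x => 'D_v f x * g x + f x * 'D_v g x)) => // [x /set_mem Ax|].
  have df := Ck_is_derive v Cf Ax; have dg := Ck_is_derive v Cg Ax.
  by apply/esym/derive_val; apply: drv_mul.
by apply: Ck_add => //; apply: IH; first [exact: Ck_derive|exact: CkS].
Qed.

Lemma Ck_opp k A f : open A -> Ck k A f -> Ck k A (fun x => - f x).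
Proof.
move=> oA Cf; apply: (eq_Ck (f := fun x => -1 * f x)) => // [x _|].
  by rewrite mulN1r.
by apply: Ck_mul => //; exact: Ck_cst.
Qed.

Lemma Ck_sub k A f g : open A -> Ck k A f -> Ck k A g -> Ck k A (fun x => f x - g x).
Proof. by move=> oA Cf Cg; apply: Ck_add => //; exact: Ck_opp. Qed.

Lemma Ck_exp k A f n : open A -> Ck k A f -> Ck k A (fun x => f x ^+ n).
Proof.
move=> oA Cf; elim: n => [|n IH].
  by apply: (eq_Ck (f := fun=> 1)) => //; exact: Ck_cst.
apply: (eq_Ck (f := fun x => f x * f x ^+ n)) => // [x _|]; first by rewrite exprS.
exact: Ck_mul.
Qed.

Lemma Ck_inv k A f : open A -> (forall x, A x -> f x != 0) -> Ck k A f ->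
  Ck k A (fun x => (f x)^-1).
Proof.
move=> oA f0; elim: k => [//|k IH] Cf; split=> [x Ax|v].
  by apply: differentiableV; [exact: Ck_differentiable Cf Ax|exact: f0].
apply: (eq_Ck (f := fun x => - ('D_v f x * ((f x)^-1 * (f x)^-1)))) => // [x /set_mem Ax|].
  have df := Ck_is_derive v Cf Ax; apply/esym/derive_val.
  apply: drv_eq; first by apply: (drv_inv (f0 _ Ax)); exact: df.
  by rewrite -invfM expr2 mulNr mulrC.
have CV := IH (CkS Cf).
by apply: Ck_opp => //; apply: Ck_mul; [|exact: Ck_derive|apply: Ck_mul].
Qed.

Lemma Ck_smooth_on A f : (forall k, Ck k A f) -> smooth_on A f.
Proof.
move=> Cf vs x Ax.
have {}Cf k : Ck k A (foldr (fun v h => 'D_v h) f vs).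
  by elim: vs k => [|v vs IH] k //=; apply: Ck_derive.
have df := Ck_differentiable (Cf 1%N) Ax.
split=> [|v]; [exact: differentiable_continuous|exact: diff_derivable].
Qed.

End Ck.

Lemma derive_scale1 (R : realType) (f : R -> R) (x v : R) :
  differentiable f x -> 'D_v f x = v * 'D_1 f x.
Proof. by move=> df; rewrite !deriveE // -{1}[v]mulr1 (linearZZ ('d f x) v 1). Qed.

(** The induction is general in [h], because the derivative of the composite contains ['D_1 h]
    composed with the same [f]. *)
Lemma Ck_comp (R : realType) (V : normedModType R) k (A : set V) (B : set R) (h : R -> R)
    (f : V -> R) :
  open A -> (forall x, A x -> B (f x)) -> Ck k B h -> Ck k A f -> Ck k A (fun x => h (f x)).
Proof.
move=> oA AB; elim: k h => [//|k IH] h Ch Cf; split=> [x Ax|v].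
  apply: (@differentiable_comp _ _ _ _ f h); first exact: Ck_differentiable Cf Ax.
  by apply: Ck_differentiable Ch _; exact: AB.
apply: (eq_Ck (f := fun x => 'D_1 h (f x) * 'D_v f x)) => // [x /set_mem Ax|].
  have df := Ck_is_derive v Cf Ax; have dh := Ck_is_derive (1 : R) Ch (AB _ Ax).
  by have dc := drv_comp dh df; rewrite (@derive_val _ _ _ _ _ _ _ dc).
by apply: Ck_mul; [|apply: (IH ('D_(1 : R) h)); [exact: Ck_derive|exact: CkS]|exact: Ck_derive].
Qed.

(** The derivative contains [Num.sqrt (f x)] itself, to which the induction hypothesis applies. *)
Lemma Ck_sqrt (R : realType) (V : normedModType R) k (A : set V) (f : V -> R) :
  open A -> (forall x, A x -> 0 < f x) -> Ck k A f -> Ck k A (fun x => Num.sqrt (f x)).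
Proof.
move=> oA f0; elim: k => [//|k IH] Cf.
have ds x v : A x -> is_derive x v (fun x => Num.sqrt (f x)) ((2 * Num.sqrt (f x))^-1 * 'D_v f x).
  by move=> Ax; apply: drv_sqrt; [exact: f0|exact: Ck_is_derive Cf Ax].
split=> [x Ax|v].
  apply: (@differentiable_comp _ _ _ _ f Num.sqrt); first exact: Ck_differentiable Cf Ax.
  by apply/derivable1_diffP; have [] := is_derive1_sqrt (f0 _ Ax).
apply: (eq_Ck (f := fun x => (2 * Num.sqrt (f x))^-1 * 'D_v f x)) => // [x /set_mem Ax|].
  by apply/esym/derive_val/ds.
apply: Ck_mul; [by []| |exact: Ck_derive].
apply: Ck_inv => // [x Ax|]; first by rewrite mulf_neq0 // gt_eqF // sqrtr_gt0 f0.
by apply: Ck_mul => //; [exact: Ck_cst|apply: IH; exact: CkS].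
Qed.

(** * Functions of two real variables *)

Section Plane.
Variable R : realType.
Implicit Types (f : R * R -> R) (A : set (R * R)).

Lemma is_derive_fst f (a b l : R) :
  is_derive (a, b) ((1, 0) : R * R) f l <-> is_derive a 1 (fun t => f (t, b)) l.
Proof.
have E : (fun h : R => h^-1 *: ((f \o shift (a, b)) (h *: ((1, 0) : R * R)) - f (a, b))) =
    (fun h : R => h^-1 *: (((fun t => f (t, b)) \o shift a) (h *: (1 : R)) - f (a, b))).
  apply/funext => h /=; congr (_ *: (f _ - _)).
  by rewrite -[LHS]/(h *: 1 + a, h *: 0 + b) scaler0 add0r.
by split=> -[df dl]; apply: DeriveDef; move: df dl; rewrite /derivable /derive E.
Qed.

Lemma is_derive_snd f (a b l : R) :
  is_derive (a, b) ((0, 1) : R * R) f l <-> is_derive b 1 (fun t => f (a, t)) l.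
Proof.
have E : (fun h : R => h^-1 *: ((f \o shift (a, b)) (h *: ((0, 1) : R * R)) - f (a, b))) =
    (fun h : R => h^-1 *: (((fun t => f (a, t)) \o shift b) (h *: (1 : R)) - f (a, b))).
  apply/funext => h /=; congr (_ *: (f _ - _)).
  by rewrite -[LHS]/(h *: 0 + a, h *: 1 + b) scaler0 add0r.
by split=> -[df dl]; apply: DeriveDef; move: df dl; rewrite /derivable /derive E.
Qed.

Lemma mvt_centered (g dg : R -> R) (a x : R) :
  (forall z, `|z - a| <= `|x - a| -> is_derive z 1 g (dg z)) ->
  exists2 z, `|z - a| <= `|x - a| & g x - g a = dg z * (x - a).
Proof.
move=> dgP.
have cont (u v : R) : (forall z, z \in `[u, v] -> `|z - a| <= `|x - a|) ->
    {within `[u, v], continuous g}.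
  move=> H; by apply: derivable_within_continuous => z /H /dgP [].
case: (leP a x) => ax.
  have H z : z \in `[a, x] -> `|z - a| <= `|x - a|.
    by rewrite in_itv /= => /andP[? ?]; rewrite !ger0_norm; lra.
  have [z zi ->] := @MVT_segment _ g dg a x ax (fun z zi => dgP z (H z (subset_itv_oo_cc zi)))
      (cont _ _ H).
  by exists z => //; exact: H.
have H z : z \in `[x, a] -> `|z - a| <= `|x - a|.
  by rewrite in_itv /= => /andP[? ?]; rewrite !ler0_norm; lra.
have [z zi E] := @MVT_segment _ g dg x a (ltW ax) (fun z zi => dgP z (H z (subset_itv_oo_cc zi)))
    (cont _ _ H).
by exists z; [exact: H|lra].
Qed.

(** The increment is split at [(a t, b s)]: the mean value theorem in the first coordinate handles
    one leg, the one-variable chain rule the other. Partial derivatives thus suffice, with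
    continuity of the first one at the point. *)
Lemma is_derive_pair f f1 A (a b : R -> R) (t a' b' l : R) :
  open A -> A (a t, b t) -> (forall p, A p -> is_derive p ((1, 0) : R * R) f (f1 p)) ->
  {for (a t, b t), continuous f1} ->
  is_derive (a t, b t) ((0, 1) : R * R) f l ->
  is_derive t 1 a a' -> is_derive t 1 b b' ->
  is_derive t 1 (fun s => f (a s, b s)) (f1 (a t, b t) * a' + l * b').
Proof.
move=> oA At df1 cf1 /is_derive_snd df2 da db.
have dk : is_derive t 1 (fun s => f (a t, b s)) (l * b').
  exact: (drv_comp df2 db).
have ca : {for t, continuous a}.
  by apply/differentiable_continuous/derivable1_diffP.
have cb : {for t, continuous b}.
  by apply/differentiable_continuous/derivable1_diffP.
have /is_derive1_caratheodory [al [aE cal <-]] := da.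
have /is_derive1_caratheodory [be [bE cbe <-]] := dk.
(* The difference quotient in the first coordinate, extended by its limit where [a s = a t]. The
   mean value theorem makes it a value of [f1] near the point, hence continuous at [t]. *)
pose k s := if a s == a t then f1 (a t, b t) else (f (a s, b s) - f (a t, b s)) / (a s - a t).
apply/is_derive1_caratheodory; exists (fun s => k s * al s + be s); split.
- move=> s; rewrite mulrDl -bE -mulrA -aE /k.
  case: eqP => [->|/eqP ne]; first by rewrite subrr mulr0 add0r.
  by rewrite divfK ?subr_eq0 // subrKA.
- apply: continuousD cbe; apply: continuousM cal.
  apply/cvgrPdist_le => e e0; rewrite /k eqxx.
  have /cvgrPdist_le /(_ e e0) nf1 := cf1.
  have /nbhs_ballP [d /= d0 dB] : \forall p \near (a t, b t), A p /\ `|f1 (a t, b t) - f1 p| <= e.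
    by near=> p; split; near: p => //; exact: open_nbhs_nbhs.
  near=> s; case: eqP => [_|/eqP ne]; first by rewrite subrr normr0 ltW.
  have as_d : `|a t - a s| < d by near: s; move/cvgrPdist_lt : ca; exact.
  have bs_d : `|b t - b s| < d by near: s; move/cvgrPdist_lt : cb; exact.
  have inB z : `|z - a t| <= `|a s - a t| -> A (z, b s) /\ `|f1 (a t, b t) - f1 (z, b s)| <= e.
    move=> zs; apply: dB; split=> //=; rewrite /ball /= distrC.
    by apply: le_lt_trans zs _; rewrite distrC.
  have [|z zs ->] := @mvt_centered (fun x => f (x, b s)) (fun x => f1 (x, b s)) (a t) (a s).
    by move=> z /inB [Az _]; apply/is_derive_fst/df1.
  by rewrite mulfK ?subr_eq0 //; have [] := inB z zs.
- by rewrite /k eqxx.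
Unshelve. all: by end_near. Qed.

Lemma is_derive_pairV (V : normedModType R) f f1 A (a b : V -> R) (x v : V) (a' b' l : R) :
  open A -> A (a x, b x) -> (forall p, A p -> is_derive p ((1, 0) : R * R) f (f1 p)) ->
  {for (a x, b x), continuous f1} ->
  is_derive (a x, b x) ((0, 1) : R * R) f l ->
  is_derive x v a a' -> is_derive x v b b' ->
  is_derive x v (fun z => f (a z, b z)) (f1 (a x, b x) * a' + l * b').
Proof.
move=> oA Ax df1 cf1 df2 /is_derive_line da /is_derive_line db; apply/is_derive_line.
have := @is_derive_pair f f1 A (fun h : R => a (h *: v + x)) (fun h : R => b (h *: v + x)) 0 a'
    b' l oA.
by rewrite scale0r add0r; apply.
Qed.

(** The mixed increment of [f] over a square of side [h] is [h * h] times a value of [f12] and also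
    [h * h] times a value of [f21], both taken near [p]: the mean value theorem is applied twice, in
    either order. *)
Lemma schwarz f f1 f2 f12 f21 A (p : R * R) : open A -> A p ->
  (forall p, A p -> is_derive p ((1, 0) : R * R) f (f1 p)) ->
  (forall p, A p -> is_derive p ((0, 1) : R * R) f (f2 p)) ->
  (forall p, A p -> is_derive p ((0, 1) : R * R) f1 (f12 p)) ->
  (forall p, A p -> is_derive p ((1, 0) : R * R) f2 (f21 p)) ->
  {for p, continuous f12} -> {for p, continuous f21} -> f12 p = f21 p.
Proof.
case: p => a b oA Ap d1 d2 d12 d21 c12 c21.
apply/eqP; rewrite -subr_eq0 -normr_le0; apply/ler_addgt0Pl => e e0; rewrite addr0.
have e20 : 0 < e / 2 by rewrite divr_gt0.
have /cvgrPdist_le /(_ _ e20) n12 := c12.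
have /cvgrPdist_le /(_ _ e20) n21 := c21.
have [d d0 dB] : exists2 d : R, 0 < d & forall p, ball (a, b) d p ->
    [/\ A p, `|f12 (a, b) - f12 p| <= e / 2 & `|f21 (a, b) - f21 p| <= e / 2].
  have nA : \forall p \near (a, b), A p by apply: open_nbhs_nbhs.
  have : nbhs (a, b) (A `&` ([set p | `|f12 (a, b) - f12 p| <= e / 2] `&`
      [set p | `|f21 (a, b) - f21 p| <= e / 2])).
    by apply: filterI; [|apply: filterI].
  move=> /nbhs_ballP [d /= d0 dB].
  by exists d => // p /dB [? [? ?]].
have [h h0 hd] : exists2 h : R, 0 < h & h < d by exists (d / 2); lra.
have inB x y : `|x - a| <= h -> `|y - b| <= h -> ball (a, b) d (x, y).
  by move=> xh yh; split; rewrite /ball /= distrC; exact: le_lt_trans hd.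
have inA x y : `|x - a| <= h -> `|y - b| <= h -> A (x, y).
  by move=> xh yh; have [] := dB _ (inB _ _ xh yh).
pose a1 := a + h; pose b1 := b + h.
have a1h : `|a1 - a| = h by rewrite addrC addKr gtr0_norm.
have b1h : `|b1 - b| = h by rewrite addrC addKr gtr0_norm.
have aa : `|a - a| <= h by rewrite subrr normr0 ltW.
have bb : `|b - b| <= h by rewrite subrr normr0 ltW.
have b1b : `|b1 - b| <= h by rewrite b1h.
have a1a : `|a1 - a| <= h by rewrite a1h.
have [|x] := @mvt_centered (fun x => f (x, b1) - f (x, b)) (fun x => f1 (x, b1) - f1 (x, b)) a a1.
  move=> z; rewrite a1h => zh.
  by apply: drv_add; [|apply: drv_opp]; apply/is_derive_fst/d1/inA.
rewrite a1h => xh E1.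
have [|y] := @mvt_centered (fun y => f1 (x, y)) (fun y => f12 (x, y)) b b1.
  by move=> z; rewrite b1h => zh; apply/is_derive_snd/d12/inA.
rewrite b1h => yh E2.
have [|y'] := @mvt_centered (fun y => f (a1, y) - f (a, y)) (fun y => f2 (a1, y) - f2 (a, y)) b b1.
  move=> z; rewrite b1h => zh.
  by apply: drv_add; [|apply: drv_opp]; apply/is_derive_snd/d2/inA.
rewrite b1h => yh' E3.
have [|x'] := @mvt_centered (fun x => f2 (x, y')) (fun x => f21 (x, y')) a a1.
  by move=> z; rewrite a1h => zh; apply/is_derive_fst/d21/inA.
rewrite a1h => xh' E4.
have E : f12 (x, y) = f21 (x', y').
  have hh : h * h != 0 by rewrite mulf_neq0 // gt_eqF.
  apply: (mulIf hh); rewrite !mulrA.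
  have ha : a1 - a = h by rewrite addrC addKr.
  have hb : b1 - b = h by rewrite addrC addKr.
  rewrite /= E2 hb ha /= in E1; rewrite /= E4 hb ha /= in E3.
  by rewrite -E1 -E3; ring.
have [_ + _] := dB _ (inB _ _ xh yh); have [_ _] := dB _ (inB _ _ xh' yh').
rewrite E; move: (f12 (a, b)) (f21 (a, b)) (f21 (x', y')) => u v w.
move=> uw vw; rewrite (_ : u - v = (u - w) - (v - w)); last ring.
by apply: le_trans (ler_normB _ _) _; rewrite [e]splitr lerD.
Unshelve. all: by end_near. Qed.

End Plane.

(** * The differential equations of a Landsberg spray at a fixed radius *)

Lemma is_derive_unique (R : realType) (V : normedModType R) (f : V -> R) x v a b :
  is_derive x v f a -> is_derive x v f b -> a = b.
Proof. by move=> [_ <-] [_ <-]. Qed.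

(** The device by which identities in m are differentiated below. *)
Lemma eq_derive_val (R : realType) (V : normedModType R) (f g : V -> R) x v a b :
  f =1 g -> is_derive x v f a -> is_derive x v g b -> a = b.
Proof. by move=> /funext ->; exact: is_derive_unique. Qed.

Lemma derive_eq0_cst (R : realType) (f f' : R -> R) :
  (forall x : R, is_derive x (1 : R) f (f' x)) -> (forall x : R, f' x = 0) -> forall x, f x = f 0.
Proof. by move=> df f0 x; apply: is_derive_0_is_cst => y; rewrite -(f0 y). Qed.

Section LandsbergODE.
(** Here [c] stands for 1/r, [t] for tau, [a] and [b] for the spray coefficients al and be; digits
    count derivatives. The fourth derivative of [b] serves to get [b3 0 = 0]. *)
Variables (R : realType) (c : R) (t t1 t2 a a1 a2 a3 b b1 b2 b3 b4 : R -> R).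
Hypotheses (dt : forall m : R, is_derive m (1 : R) t (t1 m)) (dt1 : forall m : R, is_derive m (1
    : R) t1 (t2 m)).
Hypotheses (da : forall m : R, is_derive m (1 : R) a (a1 m)) (da1 : forall m : R, is_derive m (1
    : R) a1 (a2 m))
  (da2 : forall m : R, is_derive m (1 : R) a2 (a3 m)).
Hypotheses (db : forall m : R, is_derive m (1 : R) b (b1 m)) (db1 : forall m : R, is_derive m (1
    : R) b1 (b2 m))
  (db2 : forall m : R, is_derive m (1 : R) b2 (b3 m)) (db3 : forall m : R, is_derive m (1 : R) b3
      (b4 m)).
Hypothesis horizontal : forall m, t m * (c - 2 * b m + m * b1 m) = c * m + 2 * a m - m * a1 m.
Hypothesis landsberg_ppp : forall m, t m * b3 m + a3 m = 0.
Hypothesis landsberg_vvp : forall m, t m * (b1 m - m * b2 m) = m * a2 m.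
Hypothesis t1_gt0 : forall m, 0 < t1 m.

Let g m := b1 m - m * b2 m.

Let dg m : is_derive m (1 : R) g (- (m * b3 m)).
Proof. by rewrite /g; derive_by ltac:(ring). Qed.

(** Differentiate [landsberg_vvp] and eliminate [a3] by [landsberg_ppp]; the terms in [b3]
    cancel. *)
Let a2E m : a2 m = t1 m * g m.
Proof.
have d1 : is_derive m (1 : R) (fun m => t m * g m) (t1 m * g m - t m * (m * b3 m)).
  by derive_by ltac:(ring).
have d2 : is_derive m (1 : R) (fun m => m * a2 m) (a2 m + m * a3 m).
  by derive_by ltac:(ring).
have := eq_derive_val landsberg_vvp d1 d2.
have -> : a3 m = - (t m * b3 m) by have := landsberg_ppp m; lra.
lra.
Qed.

(** The second derivative of [horizontal], again with [a3] eliminated. *)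
Let t2E m : t2 m * (c - 2 * b m + m * b1 m) = 2 * t1 m * g m.
Proof.
have h1 x : t1 x * (c - 2 * b x + x * b1 x) - t x * g x = c + a1 x - x * a2 x.
  have d1 : is_derive x (1 : R) (fun m => t m * (c - 2 * b m + m * b1 m))
      (t1 x * (c - 2 * b x + x * b1 x) - t x * g x).
    by derive_by ltac:(rewrite /g; ring).
  have d2 : is_derive x (1 : R) (fun m => c * m + 2 * a m - m * a1 m) (c + a1 x - x * a2 x).
    by derive_by ltac:(ring).
  exact: eq_derive_val horizontal d1 d2.
have d1 : is_derive m (1 : R) (fun x => t1 x * (c - 2 * b x + x * b1 x) - t x * g x)
    (t2 m * (c - 2 * b m + m * b1 m) - 2 * t1 m * g m + t m * (m * b3 m)).
  by derive_by ltac:(rewrite /g; ring).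
have d2 : is_derive m (1 : R) (fun x => c + a1 x - x * a2 x) (- (m * a3 m)).
  by derive_by ltac:(ring).
have := eq_derive_val h1 d1 d2; have -> : a3 m = - (t m * b3 m) by have := landsberg_ppp m; lra.
lra.
Qed.

Let g0 m : g m = 0.
Proof.
have zg x : (x * t1 x - t x) * g x = 0.
  by have := landsberg_vvp x; rewrite -/(g x) a2E => e; rewrite mulrBl e; ring.
(* Differentiate [zg] and multiply by [g]: the term in [b3] then contains [zg] as a factor, which
   leaves m t2 g^2 = 0. Multiplying by the cofactor of [t2] in [t2E] gives m t1 g^3 = 0, and t1 >
   0. *)
have xg x : x * g x = 0.
  have d1 : is_derive x (1 : R) (fun x => (x * t1 x - t x) * g x)
      (x * t2 x * g x - (x * t1 x - t x) * (x * b3 x)).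
    by derive_by ltac:(ring).
  have e1 := eq_derive_val zg d1 (drv_cst x (1 : R) 0).
  have e2 : x * t2 x * g x ^+ 2 = 0.
    have : g x * (x * t2 x * g x - (x * t1 x - t x) * (x * b3 x)) = 0 by rewrite e1 mulr0.
    have -> : g x * (x * t2 x * g x - (x * t1 x - t x) * (x * b3 x)) =
      x * t2 x * g x ^+ 2 - ((x * t1 x - t x) * g x) * (x * b3 x) by ring.
    by rewrite zg mul0r subr0.
  have e3 : t1 x * (x * g x ^+ 3) = 0.
    have : x * (t2 x * (c - 2 * b x + x * b1 x)) * g x ^+ 2 = 0.
      by rewrite -(mul0r (c - 2 * b x + x * b1 x)) -e2; ring.
    by rewrite t2E => h; have : 2 * (t1 x * (x * g x ^+ 3)) = 0 by [rewrite -h; ring]; lra.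
  move/eqP: e3; rewrite mulf_eq0 gt_eqF //= mulf_eq0 expf_eq0 /= => /orP[]/eqP->.
    by rewrite mul0r.
  by rewrite mulr0.
(* At m = 0 the relation m g = 0 is void, but its derivative there is [g 0]. *)
have d1 : is_derive m (1 : R) (fun x => x * g x) (g m - m ^+ 2 * b3 m).
  by derive_by ltac:(ring).
have := eq_derive_val xg d1 (drv_cst m (1 : R) 0).
have /eqP := xg m; rewrite mulf_eq0 => /orP[/eqP->|/eqP //].
by rewrite expr0n mul0r subr0.
Qed.

Let a20 m : a2 m = 0. Proof. by rewrite a2E g0 mulr0. Qed.

Lemma landsberg_alpha m : a m = a 0 + a1 0 * m.
Proof.
have a1c := derive_eq0_cst da1 a20.
have d x : is_derive x (1 : R) (fun x => a x - a1 0 * x) (a1 x - a1 0).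
  by derive_by ltac:(ring).
have := derive_eq0_cst d (fun x => etrans (congr1 (+%R^~ _) (a1c x)) (subrr _)) m.
by rewrite mulr0 subr0 => <-; rewrite subrK.
Qed.

(** Since g' = - m b3, [b3] vanishes off 0; at 0 it is the derivative of m b3. *)
Let b2c m : b2 m = b2 0.
Proof.
apply: derive_eq0_cst db2 _ m => x.
have zg y : - (y * b3 y) = 0 := eq_derive_val g0 (dg y) (drv_cst y (1 : R) 0).
have yb y : y * b3 y = 0 by apply/eqP; rewrite -oppr_eq0 zg.
have d1 : is_derive x (1 : R) (fun y => y * b3 y) (b3 x + x * b4 x).
  by derive_by ltac:(ring).
have := eq_derive_val yb d1 (drv_cst x (1 : R) 0).
have /eqP := yb x; rewrite mulf_eq0 => /orP[/eqP->|/eqP //].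
by rewrite mul0r addr0.
Qed.

Lemma landsberg_beta1 m : b1 m = b2 0 * m.
Proof. by have /eqP := g0 m; rewrite subr_eq0 b2c mulrC => /eqP. Qed.

Lemma landsberg_beta m : b m = b 0 + b2 0 / 2 * m ^+ 2.
Proof.
have d x : is_derive x (1 : R) (fun x => b x - b2 0 / 2 * x ^+ 2) (b1 x - b2 0 * x).
  by derive_by ltac:(rewrite /=; field).
have d0 x : b1 x - b2 0 * x = 0 by rewrite landsberg_beta1 subrr.
by have := derive_eq0_cst d d0 m; rewrite expr0n mulr0 subr0 => <-; rewrite subrK.
Qed.

(** The right side of [t2E] is now 0, and the quadratic parts of [- 2 b] and [m b1] cancel, so the
    cofactor of [t2] is constant. *)
Lemma landsberg_tau2 m : t2 m * (c - 2 * b 0) = 0.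
Proof.
have := t2E m; rewrite g0 mulr0 landsberg_beta landsberg_beta1 => e.
by rewrite -[RHS]e; field.
Qed.

Lemma landsberg_tau_affine m : c - 2 * b 0 != 0 -> t m = t 0 + t1 0 * m.
Proof.
move=> c0; have t20 x : t2 x = 0.
  by have /eqP := landsberg_tau2 x; rewrite mulf_eq0 (negPf c0) orbF => /eqP.
have t1c := derive_eq0_cst dt1 t20.
have d x : is_derive x (1 : R) (fun x => t x - t1 0 * x) (t1 x - t1 0).
  by derive_by ltac:(ring).
have := derive_eq0_cst d (fun x => etrans (congr1 (+%R^~ _) (t1c x)) (subrr _)) m.
by rewrite mulr0 subr0 => <-; rewrite subrK.
Qed.

Lemma landsberg_alpha0 : c - 2 * b 0 = 0 -> a 0 = 0.
Proof. by move=> c0; have := horizontal 0; rewrite !mul0r !mulr0 addr0 c0; lra. Qed.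

End LandsbergODE.

(** * Polar splitting of tangent vectors *)

Section Dot.
Variables (R : realType) (n : nat).
Implicit Types (x y z e v w : 'rV[R]_n) (c : R).

Lemma dotC x y : dot x y = dot y x.
Proof. by apply: eq_bigr => i _; rewrite mulrC. Qed.

Lemma dotDl x y z : dot (x + y) z = dot x z + dot y z.
Proof. by rewrite -big_split; apply: eq_bigr => i _; rewrite mxE mulrDl. Qed.

Lemma dotZl c x y : dot (c *: x) y = c * dot x y.
Proof. by rewrite mulr_sumr; apply: eq_bigr => i _; rewrite mxE mulrA. Qed.

Lemma dotDr x y z : dot x (y + z) = dot x y + dot x z.
Proof. by rewrite dotC dotDl !(dotC _ x). Qed.

Lemma dotZr c x y : dot x (c *: y) = c * dot x y.
Proof. by rewrite dotC dotZl dotC. Qed.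

Lemma dotNr x y : dot x (- y) = - dot x y.
Proof. by rewrite -scaleN1r dotZr mulN1r. Qed.

Lemma dotNl x y : dot (- x) y = - dot x y.
Proof. by rewrite dotC dotNr dotC. Qed.

Lemma dot0r x : dot x 0 = 0.
Proof. by rewrite -(scale0r x) dotZr mul0r. Qed.

Lemma dot_delta x (i : 'I_n) : dot x (delta_mx 0 i) = x 0 i.
Proof.
rewrite /dot (bigD1 i) //= mxE !eqxx mulr1 big1 ?addr0 // => j ji.
by rewrite mxE (negPf ji) andbF mulr0.
Qed.

Lemma dot_ge0 x : 0 <= dot x x.
Proof. by apply: sumr_ge0 => i _; rewrite -expr2 sqr_ge0. Qed.

Lemma dot_eq0 x : (dot x x == 0) = (x == 0).
Proof.
apply/eqP/eqP => [/eqP|->]; last exact: dot0r.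
rewrite psumr_eq0 => [/allP x0|i _]; last by rewrite -expr2 sqr_ge0.
apply/rowP => i; rewrite mxE; apply/eqP; rewrite -sqrf_eq0 expr2.
exact: x0 (mem_index_enum i).
Qed.

Lemma dot_gt0 x : (0 < dot x x) = (x != 0).
Proof. by rewrite lt_neqAle dot_ge0 andbT eq_sym dot_eq0. Qed.

Lemma enorm_sqr x : enorm x ^+ 2 = dot x x.
Proof. by rewrite sqr_sqrtr ?dot_ge0. Qed.

Lemma enorm_ge0 x : 0 <= enorm x.
Proof. exact: sqrtr_ge0. Qed.

Lemma enorm_gt0 x : (0 < enorm x) = (x != 0).
Proof. by rewrite sqrtr_gt0 dot_gt0. Qed.

Lemma enormZ c x : 0 <= c -> enorm (c *: x) = c * enorm x.
Proof.
move=> c0; rewrite /enorm dotZl dotZr mulrA -expr2 sqrtrM ?sqr_ge0 //.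
by rewrite sqrtr_sqr ger0_norm.
Qed.

Lemma sum_dot_delta x y : \sum_k dot x (delta_mx 0 k) * y 0 k = dot x y.
Proof. by apply: eq_bigr => k _; rewrite dot_delta. Qed.

Lemma drv_dot e y v : is_derive y v (dot e) (dot e v).
Proof.
apply/is_derive_line; rewrite (_ : (fun h => _) = (fun h : R => h * dot e v + dot e y)).
  by derive_by ltac:(ring).
by apply/funext => h; rewrite dotDr dotZr.
Qed.

Lemma drv_dotl w y v : is_derive y v (fun y => dot y w) (dot v w).
Proof.
rewrite (_ : (fun y => _) = dot w); first by rewrite dotC; exact: drv_dot.
by apply/funext => z; rewrite dotC.
Qed.

Lemma drv_dot2 y v : is_derive y v (fun y => dot y y) (2 * dot y v).
Proof.
apply/is_derive_line; rewrite (_ : (fun h => _) =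
    (fun h : R => h * (h * dot v v) + h * (2 * dot y v) + dot y y)).
  by derive_by ltac:(ring).
by apply/funext => h; rewrite !(dotDr, dotDl, dotZr, dotZl) (dotC v y); ring.
Qed.

Lemma differentiable_dot e y : differentiable (dot e) y.
Proof.
rewrite (_ : dot e = fun z => \sum_i (fun z : 'rV[R]_n => e 0 i * z 0 i) z) //.
rewrite (_ : (fun z => _) = \sum_i (fun z : 'rV[R]_n => e 0 i * z 0 i)); last first.
  by apply/funext => z; rewrite fct_sumE.
apply: differentiable_sum => i.
by apply: differentiableM; [exact: differentiable_cst|exact: differentiable_coord].
Qed.

Lemma Ck_dot k (A : set 'rV[R]_n) e : Ck k A (dot e).
Proof.
case: k => [//|k]; split=> [y _|v]; first exact: differentiable_dot.
rewrite (_ : 'D_v _ = fun=> dot e v); first exact: Ck_cst.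
by apply/funext => y; have d := drv_dot e y v; rewrite (@derive_val _ _ _ _ _ _ _ d).
Qed.

Lemma Ck_dot2 k (A : set 'rV[R]_n) : open A -> Ck k A (fun y => dot y y).
Proof.
move=> oA; suff -> : (fun y => dot y y) = fun y => \sum_(i < n) dot (delta_mx 0 i) y * dot
    (delta_mx 0 i) y.
  elim: (index_enum _) => [|i s IH].
    rewrite (_ : (fun y => _) = fun=> 0); first exact: Ck_cst.
    by apply/funext => y; rewrite big_nil.
  rewrite (_ : (fun y => _) = fun y => dot (delta_mx 0 i) y * dot (delta_mx 0 i) y +
      \sum_(i <- s) dot (delta_mx 0 i) y * dot (delta_mx 0 i) y).
    by apply: Ck_add => //; apply: Ck_mul => //; exact: Ck_dot.
  by apply/funext => y; rewrite big_cons.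
by apply/funext => y; apply: eq_bigr => i _; rewrite dotC dot_delta.
Qed.

Lemma continuous_dot2 : continuous (fun y : 'rV[R]_n => dot y y).
Proof.
by move=> y; apply/differentiable_continuous/(Ck_differentiable (Ck_dot2 1 openT)).
Qed.

Lemma continuous_enorm : continuous (@enorm R n).
Proof.
move=> y; apply: (@continuous_comp _ _ _ (fun y : 'rV[R]_n => dot y y) Num.sqrt).
  exact: continuous_dot2.
exact: sqrt_continuous.
Qed.

Lemma drv_enorm x v : x != 0 -> is_derive x v (@enorm R n) (dot x v / enorm x).
Proof.
move=> x0; have d := drv_dot2 x v; apply: drv_eq.
  by notypeclasses refine (drv_sqrt _ d); rewrite dot_gt0.
by rewrite -/(enorm x) invfM mulrACA mulVf ?pnatr_eq0 // mul1r mulrC.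
Qed.

End Dot.

Section Polar.
Variables (R : realType) (n : nat) (e : 'rV[R]_n).
Hypothesis e1 : dot e e = 1.
Implicit Types (y v w : 'rV[R]_n).

(** For a unit vector [e], the inner product of the components orthogonal to [e]. With it [pnorm] is
    the q and [slope] the m of the polar splitting. *)
Definition perp v w := dot v w - dot e v * dot e w.
Definition pnorm y := Num.sqrt (perp y y).
Definition slope y := dot e y / pnorm y.
Definition tangential : set 'rV[R]_n := [set y | 0 < perp y y].

Lemma perpC v w : perp v w = perp w v.
Proof. by rewrite /perp dotC mulrC. Qed.

Lemma perpDr v w y : perp v (w + y) = perp v w + perp v y.
Proof. by rewrite /perp !dotDr; ring. Qed.

Lemma perpZr v c w : perp v (c *: w) = c * perp v w.
Proof. by rewrite /perp !dotZr; ring. Qed.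

Lemma perp_axis v : perp v e = 0.
Proof. by rewrite /perp e1 mulr1 dotC subrr. Qed.

Lemma sum_perp_delta v w : \sum_k perp v (delta_mx 0 k) * w 0 k = perp v w.
Proof.
rewrite /perp -!sum_dot_delta mulr_sumr -sumrB; apply: eq_bigr => k _.
by rewrite !dot_delta; ring.
Qed.

Lemma pnorm_gt0 y : tangential y -> 0 < pnorm y.
Proof. by rewrite sqrtr_gt0. Qed.

Lemma pnorm_neq0 y : tangential y -> pnorm y != 0.
Proof. by move=> /pnorm_gt0 /lt0r_neq0. Qed.

Lemma pnorm_sqr y : tangential y -> pnorm y ^+ 2 = perp y y.
Proof. by move=> ty; rewrite sqr_sqrtr // ltW. Qed.

Lemma dot_slope y : tangential y -> dot e y = slope y * pnorm y.
Proof. by move=> ty; rewrite /slope divfK // pnorm_neq0. Qed.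

Lemma drv_perpl w y v : is_derive y v (perp ^~ w) (perp v w).
Proof.
have d1 := drv_dotl w y v; have d2 := drv_dot e y v.
by rewrite /perp; derive_by ltac:(ring).
Qed.

Lemma drv_perp2 y v : is_derive y v (fun y => perp y y) (2 * perp y v).
Proof.
have d1 := drv_dot2 y v; have d2 := drv_dot e y v.
by rewrite /perp; derive_by ltac:(ring).
Qed.

Lemma Ck_perp2 k (A : set 'rV[R]_n) : open A -> Ck k A (fun y => perp y y).
Proof.
by move=> oA; apply: Ck_sub => //; [exact: Ck_dot2|apply: Ck_mul => //; exact: Ck_dot].
Qed.

Lemma open_tangential : open tangential.
Proof.
apply: (@open_comp _ _ (fun y => perp y y) [set t | 0 < t]); last exact: open_gt.
by move=> y _; apply/differentiable_continuous/(Ck_differentiable (Ck_perp2 1 openT)).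
Qed.

Lemma Ck_pnorm k : Ck k tangential pnorm.
Proof. by apply: Ck_sqrt => //; [exact: open_tangential|apply: Ck_perp2; exact: open_tangential].
    Qed.

Lemma Ck_slope k : Ck k tangential slope.
Proof.
have oT := open_tangential.
by apply: Ck_mul => //; [exact: Ck_dot|apply: Ck_inv => //; [exact: pnorm_neq0|exact: Ck_pnorm]].
Qed.

Lemma drv_pnorm y v : tangential y -> is_derive y v pnorm (perp y v / pnorm y).
Proof.
move=> ty; have d := drv_perp2 y v; apply: drv_eq.
  by notypeclasses refine (drv_sqrt (f := fun y => perp y y) ty d).
by rewrite -/(pnorm y) invfM mulrACA mulVf ?pnatr_eq0 // mul1r mulrC.
Qed.

Lemma drv_slope y v : tangential y ->
  is_derive y v slope ((dot e v - slope y * (perp y v / pnorm y)) / pnorm y).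
Proof.
move=> ty; have q0 := pnorm_neq0 ty.
have d1 := drv_pnorm v ty; have d2 := drv_dot e y v.
rewrite /slope; notypeclasses refine (drv_eq _ _).
  by notypeclasses refine (drv_mul d2 (drv_inv q0 d1)).
by cbv beta; field.
Qed.

End Polar.

Lemma derive_on (R : realType) (V : normedModType R) (A : set V) (f g g1 : V -> R) v :
  open A -> {in A, f =1 g} -> (forall y, A y -> is_derive y v g (g1 y)) ->
  {in A, 'D_v f =1 g1}.
Proof.
move=> oA fg dg y yA; rewrite (eq_derive_on v oA fg yA).
by have [] := dg y (set_mem yA).
Qed.

(** * Fibre derivatives of F^2 = q^2 psi(m) *)

Section Energy.
Variables (R : realType) (n : nat) (e : 'rV[R]_n).
Hypothesis e1 : dot e e = 1.
Variables psi psi1 psi2 : R -> R.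
Hypotheses (dpsi : forall m : R, is_derive m (1 : R) psi (psi1 m))
           (dpsi1 : forall m : R, is_derive m (1 : R) psi1 (psi2 m)).
Implicit Types (y z v w : 'rV[R]_n).

Let q y := pnorm e y.
Let s y := slope e y.

Definition energy_grad v y :=
  (2 * psi (s y) - s y * psi1 (s y)) * perp e y v + q y * psi1 (s y) * dot e v.

(** Here [ew] is the derivative of q along [w], and [dot e w - s y * ew] is q times the derivative
    of the slope. *)
Definition energy_hess w v y :=
  let ew := perp e y w / q y in let ev := perp e y v / q y in
  (2 * psi (s y) - s y * psi1 (s y)) * perp e w v
  + (psi1 (s y) - s y * psi2 (s y)) * (dot e w - s y * ew) * ev
  + (psi1 (s y) * ew + psi2 (s y) * (dot e w - s y * ew)) * dot e v.

Lemma drv_energy y v : tangential e y ->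
  is_derive y v (fun y => pnorm e y ^+ 2 * psi (slope e y)) (energy_grad v y).
Proof.
move=> ty; have q0 := pnorm_neq0 ty.
have d1 := drv_pnorm v ty; have d2 := drv_slope v ty.
by derive_by ltac:(rewrite /energy_grad /s /q /=; field).
Qed.

Lemma drv_energy_grad y v w : tangential e y ->
  is_derive y w (energy_grad v) (energy_hess w v y).
Proof.
move=> ty; have q0 := pnorm_neq0 ty.
have d1 := drv_pnorm w ty; have d2 := drv_slope w ty; have d3 := drv_perpl e v y w.
by rewrite /energy_grad /q /s; derive_by ltac:(rewrite /energy_hess /s /q /=; field).
Qed.

(** Linearity in the second slot: the metric can be evaluated on vectors instead of through its
    entries. *)
Lemma sum_energy_hess v z y :
  \sum_k energy_hess v (delta_mx 0 k) y * z 0 k = energy_hess v z y.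
Proof.
rewrite /energy_hess -!(sum_perp_delta e _ z) -(sum_dot_delta e z).
rewrite !mulr_sumr !mulr_suml !mulr_sumr -!big_split; apply: eq_bigr => k _ /=; ring.
Qed.

Lemma energy_hessC v w y : energy_hess v w y = energy_hess w v y.
Proof. by rewrite /energy_hess (perpC e v w); ring. Qed.

End Energy.

(** * Base derivatives of F^2, where the axis turns with x *)

Section XDerivative.
Variables (R : realType) (n : nat).
Implicit Types (x y v w : 'rV[R]_n).

Definition axis x : 'rV[R]_n := (enorm x)^-1 *: x.

Lemma axis_unit x : x != 0 -> dot (axis x) (axis x) = 1.
Proof.
move=> x0; rewrite dotZl dotZr -enorm_sqr; field.
by rewrite gt_eqF // enorm_gt0.
Qed.

Lemma dot_axis x y : dot (axis x) y = dot x y / enorm x.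
Proof. by rewrite dotZl mulrC. Qed.

Lemma nonradialE x y : nonradial x y <-> dot x y ^+ 2 < dot x x * dot y y.
Proof.
rewrite /nonradial -!enorm_sqr -exprMn.
by rewrite -[dot x y ^+ 2]real_normK ?num_real // ltr_sqr ?nnegrE ?mulr_ge0 ?enorm_ge0.
Qed.

Lemma nonradialP x y : nonradial x y <-> x != 0 /\ tangential (axis x) y.
Proof.
split=> [nr|[x0 ty]].
  have x0 : x != 0.
    apply/eqP => x0; move: nr; rewrite /nonradial x0 /enorm dot0r sqrtr0 mul0r.
    by rewrite ltNge normr_ge0.
  split=> //; move/nonradialE: nr; rewrite /tangential /= /perp dot_axis subr_gt0.
  by rewrite -expr2 expr_div_n ltr_pdivrMr ?exprn_gt0 ?enorm_gt0 // enorm_sqr mulrC.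
apply/nonradialE; move: ty; rewrite /tangential /= /perp dot_axis subr_gt0.
by rewrite -expr2 expr_div_n ltr_pdivrMr ?exprn_gt0 ?enorm_gt0 // enorm_sqr mulrC.
Qed.

Lemma open_nonradial_base y : open [set x | nonradial x y].
Proof.
rewrite (_ : [set x | _] = [set x | 0 < dot x x * dot y y - dot x y ^+ 2]); last first.
  by apply/seteqP; split=> x /= ; rewrite subr_gt0 => /nonradialE.
apply: (@open_comp _ _ (fun x => dot x x * dot y y - dot x y ^+ 2) [set t | 0 < t]); last exact:
    open_gt.
move=> x _; apply/differentiable_continuous.
have oT := @openT 'rV[R]_n; apply: (@Ck_differentiable _ _ 0 setT _ x _ I).
apply: Ck_sub => [//||].
  by apply: Ck_mul; [exact: oT|exact: Ck_dot2|exact: Ck_cst].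
apply: Ck_exp => [//|]; rewrite (_ : (fun x => _) = dot y); first exact: Ck_dot.
by apply/funext => z; rewrite dotC.
Qed.

(** The axis moves by the component of [v] orthogonal to it, divided by |x|. *)
Lemma drv_dot_axis x y v : x != 0 ->
  is_derive x v (fun x => dot (axis x) y) (perp (axis x) y v / enorm x).
Proof.
move=> x0; have r0 : enorm x != 0 by rewrite gt_eqF // enorm_gt0.
have d1 := drv_enorm v x0; have d2 := drv_dotl y x v.
rewrite (_ : (fun x => _) = fun x => dot x y / enorm x); last first.
  by apply/funext => z; rewrite dot_axis.
notypeclasses refine (drv_eq _ _).
  by notypeclasses refine (drv_mul d2 (drv_inv r0 d1)).
by cbv beta; rewrite /perp !dot_axis (dotC v); field.
Qed.

Lemma drv_perp_axis x y v : x != 0 ->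
  is_derive x v (fun x => perp (axis x) y y) (- (2 * dot (axis x) y * (perp (axis x) y v / enorm
      x))).
Proof.
move=> x0; have d := drv_dot_axis y v x0.
by rewrite /perp; derive_by ltac:(rewrite -/(perp (axis x) y v); ring).
Qed.

(** Since p^2 + q^2 = |y|^2 is fixed, q' = - m p', hence m' = (1 + m^2) p' / q. *)
Lemma drv_slope_axis x y v : x != 0 -> tangential (axis x) y ->
  let m := slope (axis x) y in
  is_derive x v (fun x => slope (axis x) y)
    ((1 + m ^+ 2) * perp (axis x) y v / (pnorm (axis x) y * enorm x)).
Proof.
move=> x0 ty; have r0 : enorm x != 0 by rewrite gt_eqF // enorm_gt0.
have q0 := pnorm_neq0 ty.
have d1 := drv_dot_axis y v x0; have d2 := drv_perp_axis y v x0.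
rewrite /slope /pnorm; notypeclasses refine (drv_eq _ _).
  notypeclasses refine (drv_mul d1 (drv_inv _ (drv_sqrt (f := fun x => perp (axis x) y y) ty d2))).
  by [].
cbv beta; rewrite -/(pnorm (axis x) y); field.
by rewrite ?q0 ?r0.
Qed.

Variables (f f1 f2 : R * R -> R) (A : set (R * R)).
Hypotheses (oA : open A) (df1 : forall p, A p -> is_derive p ((1, 0) : R * R) f (f1 p))
  (df2 : forall p, A p -> is_derive p ((0, 1) : R * R) f (f2 p))
  (cf1 : forall p, A p -> {for p, continuous f1}).

(** The first term is the radial change. In the second, turning the axis changes q^2 by - 2 m q p'
    and m by (1 + m^2) p' / q; its coefficient is the later [theta]. *)
Lemma drv_energy_base x y v : x != 0 -> tangential (axis x) y ->
  let q := pnorm (axis x) y in let m := slope (axis x) y in let r := enorm x in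
  A (r, m) ->
  is_derive x v (fun x => perp (axis x) y y * f (enorm x, slope (axis x) y))
    (q ^+ 2 * f1 (r, m) * dot (axis x) v
     + q * ((f2 (r, m) * (1 + m ^+ 2) - 2 * m * f (r, m)) / r) * perp (axis x) y v).
Proof.
move=> x0 ty q m r Arm; have r0 : enorm x != 0 by rewrite gt_eqF // enorm_gt0.
have q0 := pnorm_neq0 ty.
have d1 := drv_perp_axis y v x0; have d2 := drv_slope_axis v x0 ty; have d3 := drv_enorm v x0.
have d4 := is_derive_pairV (a := @enorm R n) (b := fun x => slope (axis x) y) oA Arm df1 (cf1
    Arm) (df2 Arm) d3 d2.
notypeclasses refine (drv_eq (drv_mul d1 d4) _).
cbv beta; rewrite -/q -/m -/r -pnorm_sqr // -/q (dot_slope ty) -/m -/q dot_axis -/r.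
by field; rewrite r0 q0.
Qed.

End XDerivative.

(** * The spray and the Landsberg equations *)

Lemma posdef_unitmx (R : realType) n (M : 'M[R]_n) : posdef M -> M \in unitmx.
Proof.
move=> pM; rewrite -row_free_unit -kermx_eq0; apply/eqP/row_matrixP => i; rewrite row0.
apply/eqP; apply: contraT => /pM.
have /sub_kermxP -> : (row i (kermx M) <= kermx M)%MS by exact: row_sub.
by rewrite mul0mx mxE ltxx.
Qed.

Lemma quad_form (R : realType) n (M : 'M[R]_n) (v : 'rV[R]_n) :
  (v *m M *m v^T) 0 0 = \sum_i (\sum_j M i j * v 0 j) * v 0 i.
Proof.
rewrite -mulmxA mxE; apply: eq_bigr => i _; rewrite mulrC mxE; congr (_ * _).
by apply: eq_bigr => j _; rewrite mxE.
Qed.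

Section SprayAt.
Variables (R : realType) (n : nat) (F : 'rV[R]_n -> 'rV[R]_n -> R) (x e : 'rV[R]_n).
Hypothesis e1 : dot e e = 1.
Variables psi psi1 psi2 psir psir1 theta theta1 : R -> R.
Hypotheses (dpsi : forall m : R, is_derive m (1 : R) psi (psi1 m))
  (dpsi1 : forall m : R, is_derive m (1 : R) psi1 (psi2 m))
  (dpsir : forall m : R, is_derive m (1 : R) psir (psir1 m))
  (dtheta : forall m : R, is_derive m (1 : R) theta (theta1 m)).
Hypothesis sqFE : {in tangential e, sqF F x =1 fun y => pnorm e y ^+ 2 * psi (slope e y)}.
Hypothesis dxF : forall v, {in tangential e, (fun y => 'D_v (fun x => sqF F x y) x) =1
  fun y => pnorm e y ^+ 2 * psir (slope e y) * dot e v
           + pnorm e y * theta (slope e y) * perp e y v}.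
Implicit Types y v w : 'rV[R]_n.

Let oT := @open_tangential R n e.

Lemma metric_tensorE y : tangential e y -> metric_tensor F x y =
  \matrix_(i, j) (2^-1 * energy_hess e psi psi1 psi2 (delta_mx 0 i) (delta_mx 0 j) y).
Proof.
move=> ty; apply/matrixP => i j; rewrite !mxE; congr (_ * _); rewrite /partial_y.
have D1 := derive_on oT sqFE (fun y ty => drv_energy dpsi (delta_mx 0 j) ty).
exact: (derive_on oT D1 (fun y ty => drv_energy_grad dpsi dpsi1 (delta_mx 0 j) (delta_mx 0 i)
    ty)) (mem_set ty).
Qed.

Lemma metric_tensor_quad y v : tangential e y ->
  (v *m metric_tensor F x y *m v^T) 0 0 = 2^-1 * energy_hess e psi psi1 psi2 v v y.
Proof.
move=> ty; rewrite quad_form metric_tensorE // -sum_energy_hess mulr_sumr.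
apply: eq_bigr => i _; rewrite mulrA; congr (_ * _).
rewrite energy_hessC -sum_energy_hess mulr_sumr; apply: eq_bigr => j _.
by rewrite mxE mulrA.
Qed.

Lemma dyxF y v w : tangential e y ->
  let q := pnorm e y in let m := slope e y in let ew := perp e y w / q in
  'D_w (fun y => 'D_v (fun x => sqF F x y) x) y =
    (2 * q * ew * psir m + q * psir1 m * (dot e w - m * ew)) * dot e v
    + (ew * theta m + theta1 m * (dot e w - m * ew)) * perp e y v
    + q * theta m * perp e w v.
Proof.
move=> ty q m ew; rewrite (eq_derive_on w oT (dxF v) (mem_set ty)).
have q0 := pnorm_neq0 ty.
have d1 := drv_pnorm w ty; have d2 := drv_slope w ty; have d3 := drv_perpl e v y w.
suff d : is_derive y w (fun y => pnorm e y ^+ 2 * psir (slope e y) * dot e v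
           + pnorm e y * theta (slope e y) * perp e y v)
    ((2 * q * ew * psir m + q * psir1 m * (dot e w - m * ew)) * dot e v
    + (ew * theta m + theta1 m * (dot e w - m * ew)) * perp e y v
    + q * theta m * perp e w v) by rewrite (@derive_val _ _ _ _ _ _ _ d).
by derive_by ltac:(rewrite /ew /q /m /=; field).
Qed.

(** Rather than inverting the metric, one checks that it maps 4 G to the bracket in the spray
    formula. Tested on [w], both sides are q^2 times a combination of [ew] and [dot e w - m * ew];
    the two scalar equations equate the coefficients of these two forms. *)
Lemma spray_polar y (a b : R) : tangential e y ->
  let q := pnorm e y in let m := slope e y in
  posdef (metric_tensor F x y) ->
  2 * (psi1 m * b + (2 * psi m - m * psi1 m) * a) = m * psir m + theta m ->
  2 * (psi2 m * b + (psi1 m - m * psi2 m) * a) = m * psir1 m - psir m + theta1 m ->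
  forall i, spray F i x y = q * a * (y 0 i - dot e y * e 0 i) + q ^+ 2 * b * e 0 i.
Proof.
move=> ty q m pg eqA eqB i; have q0 := pnorm_neq0 ty; rewrite -/q in q0.
pose G : 'rV[R]_n := (q * a) *: (y - dot e y *: e) + (q ^+ 2 * b) *: e.
transitivity (G 0 i); last by rewrite /G !mxE; ring.
pose rhs l := (\sum_k partial_y l (partial_x k (sqF F)) x y * y 0 k) - partial_x l (sqF F) x y.
have eG : dot e G = q ^+ 2 * b.
  by rewrite !(dotDr, dotZr, dotNr) e1; ring.
have pG w : perp e w G = q * a * perp e w y.
  by rewrite perpDr !perpZr perpDr -scaleNr perpZr (perp_axis e1); ring.
have rhsE l : rhs l = 4 * \sum_k metric_tensor F x y l k * G 0 k.
  set w : 'rV[R]_n := delta_mx 0 l.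
  have -> : \sum_k metric_tensor F x y l k * G 0 k = 2^-1 * energy_hess e psi psi1 psi2 w G y.
    rewrite -sum_energy_hess mulr_sumr metric_tensorE //.
    by apply: eq_bigr => k _; rewrite mxE mulrA.
  rewrite /rhs /partial_y /partial_x -/w (dxF w (mem_set ty)).
  have -> : \sum_k 'D_w (fun y0 => 'D_(delta_mx 0 k) (fun x' => sqF F x' y0) x) y * y 0 k =
      (2 * q * (perp e y w / q) * psir m + q * psir1 m * (dot e w - m * (perp e y w / q))) * dot e y
    + (perp e y w / q * theta m + theta1 m * (dot e w - m * (perp e y w / q))) * perp e y y
    + q * theta m * perp e w y.
    rewrite -(sum_dot_delta e y) -!(sum_perp_delta e _ y) !mulr_sumr -!big_split.
    by apply: eq_bigr => k _ /=; rewrite dyxF // -/q -/m; ring.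
  rewrite /energy_hess eG !pG -/q -/m -pnorm_sqr // -/q (perpC e w y) (dot_slope ty) -/q -/m.
  have -> : theta1 m = 2 * (psi2 m * b + (psi1 m - m * psi2 m) * a) - m * psir1 m + psir m.
    by rewrite eqB; ring.
  have -> : theta m = 2 * (psi1 m * b + (2 * psi m - m * psi1 m) * a) - m * psir m.
    by rewrite eqA; ring.
  by field.
have gG : invmx (metric_tensor F x y) *m (\col_l rhs l) = 4 *: G^T.
  have -> : \col_l rhs l = 4 *: (metric_tensor F x y *m G^T).
    apply/colP => l; rewrite !mxE rhsE; congr (_ * _).
    by apply: eq_bigr => k _; rewrite !mxE.
  by rewrite -scalemxAr mulKmx // posdef_unitmx.
have gGi := congr1 (fun M : 'cV_n => M i 0) gG.
rewrite /= [LHS]mxE [RHS]mxE [X in _ = _ * X]mxE in gGi.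
rewrite /spray; transitivity (4^-1 * (4 * G 0 i)); last by rewrite mulKf ?pnatr_eq0.
by congr (_ * _); rewrite -gGi; apply: eq_bigr => l _; rewrite mxE.
Qed.

End SprayAt.

(** Two linear conditions on at least three coordinates have a nonzero common solution. *)
Lemma exists_orthogonal_unit (R : realType) (n : nat) (a b : 'rV[R]_n) : (3 <= n)%N ->
  exists v, [/\ dot v v = 1, dot a v = 0 & dot b v = 0].
Proof.
move=> n3; pose M : 'M[R]_(n, 1 + 1) := (col_mx a b)^T.
have : kermx M != 0.
  rewrite -mxrank_eq0 mxrank_ker subn_eq0 -ltnNge.
  by apply: leq_ltn_trans (rank_leq_col _) _.
rewrite -nz_row_eq0; set u := nz_row _ => u0.
have uM : u *m M = 0 by apply/sub_kermxP/nz_row_sub.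
have [ua ub] : dot a u = 0 /\ dot b u = 0.
  move: uM; rewrite /M tr_col_mx mul_mx_row -[X in _ = X]row_mx0 => /eq_row_mx [ea eb].
  have dE c : dot c u = (u *m c^T) 0 0.
    by rewrite mxE; apply: eq_bigr => k _; rewrite mxE mulrC.
  by rewrite !dE ea eb mxE.
exists ((enorm u)^-1 *: u); split; first exact: axis_unit.
- by rewrite dotZr ua mulr0.
- by rewrite dotZr ub mulr0.
Qed.

Lemma exchange_sum_mul (R : realType) n (f a : 'I_n -> R) (g : 'I_n -> 'I_n -> R) :
  \sum_i f i * (\sum_j a j * g i j) = \sum_j a j * (\sum_i f i * g i j).
Proof.
under eq_bigr do rewrite mulr_sumr; rewrite exchange_big; apply: eq_bigr => j _ /=.
by rewrite mulr_sumr; apply: eq_bigr => i _; rewrite mulrCA.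
Qed.

Section Contraction.
Variables (R : realType) (n : nat) (A : set 'rV[R]_n).
Hypothesis oA : open A.
Implicit Types (f : 'rV[R]_n -> R) (y a b c v : 'rV[R]_n).

Lemma derive_sum_delta f y v : differentiable f y ->
  'D_v f y = \sum_j v 0 j * 'D_(delta_mx 0 j) f y.
Proof.
move=> df; rewrite deriveE // {1}[v]row_sum_delta linear_sum.
by apply: eq_bigr => j _; rewrite linearZ deriveE.
Qed.

Lemma derive_sum_on f (g : 'I_n -> 'rV[R]_n -> R) c v :
  (forall l, Ck 1 A (g l)) -> {in A, f =1 fun y => \sum_l c 0 l * g l y} ->
  {in A, 'D_v f =1 fun y => \sum_l c 0 l * 'D_v (g l) y}.
Proof.
move=> Cg fE; apply: (derive_on oA fE) => y Ay.
have d l : is_derive y v (fun y => c 0 l * g l y) (c 0 l * 'D_v (g l) y).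
  have dg := Ck_is_derive v (Cg l) Ay.
  by derive_by ltac:(ring).
have := is_derive_sum d; congr (is_derive _ _ _ _).
by apply/funext => z; rewrite fct_sumE.
Qed.

(** This turns the coordinate components of the curvature into derivatives along frame vectors. Each
    expansion is established on all of [A], since it is differentiated again. *)
Lemma derive3_sum_delta f a b c y : Ck 3 A f -> A y ->
  'D_a ('D_b ('D_c f)) y = \sum_j a 0 j * (\sum_k b 0 k * (\sum_l c 0 l *
    'D_(delta_mx 0 j) ('D_(delta_mx 0 k) ('D_(delta_mx 0 l) f)) y)).
Proof.
move=> Cf Ay.
have Cc := Ck_derive c Cf; have Cbc := Ck_derive b Cc.
apply: etrans (derive_sum_delta a (Ck_differentiable Cbc Ay)) _.
apply: eq_bigr => j _; congr (_ * _).
have E1 : {in A, 'D_b ('D_c f) =1 fun y => \sum_k b 0 k * 'D_(delta_mx 0 k) ('D_c f) y}.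
  by move=> z /set_mem Az; exact: derive_sum_delta (Ck_differentiable Cc Az).
have E1' := derive_sum_on (delta_mx 0 j) (fun k => Ck_derive (delta_mx 0 k) Cc) E1.
apply: etrans (E1' y (mem_set Ay)) _; apply: eq_bigr => k _; congr (_ * _).
have E2 : {in A, 'D_c f =1 fun y => \sum_l c 0 l * 'D_(delta_mx 0 l) f y}.
  by move=> z /set_mem Az; exact: derive_sum_delta (Ck_differentiable Cf Az).
have E3 := derive_sum_on (delta_mx 0 k) (fun l => CkS (Ck_derive (delta_mx 0 l) Cf)) E2.
have E4 := derive_sum_on (delta_mx 0 j)
  (fun l => Ck_derive (delta_mx 0 k) (Ck_derive (delta_mx 0 l) Cf)) E3.
exact: E4 (mem_set Ay).
Qed.

End Contraction.

(** * The Landsberg equations in an orthonormal frame *)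

Section LandsbergAt.
Variables (R : realType) (n : nat) (F : 'rV[R]_n -> 'rV[R]_n -> R) (x e : 'rV[R]_n).
Hypothesis e1 : dot e e = 1.
Variables h h' al al1 al2 al3 be be1 be2 be3 : R -> R.
Hypotheses (Ch : Ck 1 setT h) (dh : forall m : R, is_derive m (1 : R) h (h' m)).
Hypotheses (dal : forall m : R, is_derive m (1 : R) al (al1 m))
  (dal1 : forall m : R, is_derive m (1 : R) al1 (al2 m))
  (dal2 : forall m : R, is_derive m (1 : R) al2 (al3 m))
  (dbe : forall m : R, is_derive m (1 : R) be (be1 m))
  (dbe1 : forall m : R, is_derive m (1 : R) be1 (be2 m))
  (dbe2 : forall m : R, is_derive m (1 : R) be2 (be3 m)).
Hypotheses (Cal : forall k, Ck k setT al) (Cbe : forall k, Ck k setT be).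
Hypothesis FE : {in tangential e, F x =1 fun y => pnorm e y * h (slope e y)}.
Hypothesis sprayE : forall i, {in tangential e, spray F i x =1 fun y =>
  pnorm e y * al (slope e y) * (y 0 i - dot e y * e 0 i)
  + pnorm e y ^+ 2 * be (slope e y) * e 0 i}.
Hypothesis landsberg : forall y, tangential e y -> 0 < F x y /\
  forall j k l, landsberg_curvature F j k l x y = 0.
Implicit Types (y v w : 'rV[R]_n).

Let oT := @open_tangential R n e.

Lemma Ck_spray k i : Ck k (tangential e) (spray F i x).
Proof.
apply: (eq_Ck oT (f := fun y => pnorm e y * al (slope e y) * (y 0 i - dot e y * e 0 i)
  + pnorm e y ^+ 2 * be (slope e y) * e 0 i)) => [y /sprayE //|].
have Cy : Ck k (tangential e) (fun y => y 0 i).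
  rewrite (_ : (fun y => _) = dot (delta_mx 0 i)); first exact: Ck_dot.
  by apply/funext => y; rewrite dotC dot_delta.
have Cc c : Ck k (tangential e) (fun=> c) := Ck_cst k _ c.
have Cq := Ck_pnorm e k; have Cm := Ck_slope e k.
have Calm := Ck_comp oT (fun _ _ => I) (Cal k) Cm.
have Cbem := Ck_comp oT (fun _ _ => I) (Cbe k) Cm.
apply: (Ck_add oT).
  apply: (Ck_mul oT); first exact: (Ck_mul oT Cq Calm).
  by apply: (Ck_sub oT Cy); exact: (Ck_mul oT (Ck_dot k _ e) (Cc _)).
apply: (Ck_mul oT _ (Cc _)); apply: (Ck_mul oT _ Cbem); exact: (Ck_exp 2 oT Cq).
Qed.

Lemma landsberg_contracted a b c y : tangential e y ->
  \sum_i partial_y i F x y * 'D_a ('D_b ('D_c (spray F i x))) y = 0.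
Proof.
move=> ty; have [F0 LF] := landsberg ty.
have E i : 'D_a ('D_b ('D_c (spray F i x))) y = _ := derive3_sum_delta oT a b c (Ck_spray 3 i) ty.
rewrite (eq_bigr _ (fun i _ => congr1 (fun t => partial_y i F x y * t) (E i))) => {E}.
have mul0 (c0 t : R) : t = 0 -> c0 * t = 0 by move=> ->; rewrite mulr0.
apply: etrans (exchange_sum_mul _ _ _) _; apply: big1 => j _; apply: (mul0 _ _).
apply: etrans (exchange_sum_mul _ _ _) _; apply: big1 => k _; apply: (mul0 _ _).
apply: etrans (exchange_sum_mul _ _ _) _; apply: big1 => l _; apply: (mul0 _ _).
have /eqP := LF j k l; rewrite /landsberg_curvature mulf_eq0 mulf_eq0 (gt_eqF F0) orbF.
by rewrite oppr_eq0 invr_eq0 pnatr_eq0 /= => /eqP.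
Qed.

Lemma differentiable_F y : tangential e y -> differentiable (F x) y.
Proof.
move=> ty; suff : Ck 1 (tangential e) (F x) by move=> /Ck_differentiable; apply.
apply: (eq_Ck oT (f := fun y => pnorm e y * h (slope e y))) => [z /FE //|].
apply: (Ck_mul oT); first exact: Ck_pnorm.
exact: (Ck_comp oT (fun _ _ => I) Ch (Ck_slope e 1)).
Qed.

Let drv_coord y v i : is_derive y v (fun y : 'rV[R]_n => y 0 i) (v 0 i).
Proof.
rewrite (_ : (fun y => _) = dot (delta_mx 0 i)); last first.
  by apply/funext => z; rewrite dotC dot_delta.
by rewrite -dot_delta dotC; exact: drv_dot.
Qed.

(** Along the axis q and y - p e are constant and m moves at speed 1 / q, so derivatives along [e]
    act on the coefficients [al] and [be] only. *)
Let drv_e y : tangential e y ->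
  is_derive y e (pnorm e) 0 /\ is_derive y e (slope e) (pnorm e y)^-1.
Proof.
move=> ty; split.
  by apply: drv_eq (drv_pnorm e ty) _; rewrite (perp_axis e1) mul0r.
by apply: drv_eq (drv_slope e ty) _; rewrite (perp_axis e1) e1 mul0r mulr0 subr0 mul1r.
Qed.

Let spray_De i : {in tangential e, 'D_e (spray F i x) =1 fun y =>
  al1 (slope e y) * (y 0 i - dot e y * e 0 i) + pnorm e y * be1 (slope e y) * e 0 i}.
Proof.
apply: (derive_on oT (sprayE i)) => y ty; have q0 := pnorm_neq0 ty.
have [d1 d2] := drv_e ty; have d3 := drv_coord y e i; have d4 := drv_dot e y e.
by derive_by ltac:(rewrite e1 /=; field).
Qed.

Let spray_Dee i y : tangential e y -> is_derive y e (fun y =>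
  al1 (slope e y) * (y 0 i - dot e y * e 0 i) + pnorm e y * be1 (slope e y) * e 0 i)
  (al2 (slope e y) * (y 0 i - dot e y * e 0 i) / pnorm e y + be2 (slope e y) * e 0 i).
Proof.
move=> ty; have q0 := pnorm_neq0 ty.
have [d1 d2] := drv_e ty; have d3 := drv_coord y e i; have d4 := drv_dot e y e.
by derive_by ltac:(rewrite e1 /=; field).
Qed.

Let spray_Deee i y : tangential e y -> is_derive y e (fun y =>
  al2 (slope e y) * (y 0 i - dot e y * e 0 i) / pnorm e y + be2 (slope e y) * e 0 i)
  (al3 (slope e y) * (y 0 i - dot e y * e 0 i) / pnorm e y ^+ 2
   + be3 (slope e y) / pnorm e y * e 0 i).
Proof.
move=> ty; have q0 := pnorm_neq0 ty.
have [d1 d2] := drv_e ty; have d3 := drv_coord y e i; have d4 := drv_dot e y e.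
notypeclasses refine (drv_eq _ _); [drv|]; first exact: q0.
by rewrite e1 /=; field.
Qed.

Section Frame.
Variables (w : 'rV[R]_n) (m : R).
Hypotheses (w1 : dot w w = 1) (ew : dot e w = 0).

Let y := m *: e + w.

Lemma frame_facts : [/\ dot e y = m, perp e y y = 1, tangential e y, pnorm e y = 1 & slope e y = m].
Proof.
have ey : dot e y = m by rewrite dotDr dotZr e1 ew mulr1 addr0.
have py : perp e y y = 1.
  by rewrite /perp ey /y !(dotDl, dotDr, dotZl, dotZr) e1 w1 (dotC w) ew; ring.
have qy : pnorm e y = 1 by rewrite /pnorm py sqrtr1.
by split => //; [rewrite /tangential /= py|rewrite /slope qy ey divr1].
Qed.

Lemma frame_dF : \sum_i partial_y i F x y * e 0 i = h' m /\
  \sum_i partial_y i F x y * w 0 i = h m - m * h' m.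
Proof.
have [ey py ty qy sy] := frame_facts.
have dF v : \sum_i partial_y i F x y * v 0 i = 'D_v (F x) y.
  rewrite (derive_sum_delta _ (differentiable_F ty)).
  by apply: eq_bigr => i _; rewrite mulrC.
have D v : 'D_v (F x) y = perp e y v * h m + h' m * (dot e v - m * perp e y v).
  rewrite (eq_derive_on v oT FE (mem_set ty)).
  have d1 := drv_pnorm v ty; have d2 := drv_slope v ty.
  suff d : is_derive y v (fun y => pnorm e y * h (slope e y))
     (perp e y v * h m + h' m * (dot e v - m * perp e y v)).
    by rewrite (@derive_val _ _ _ _ _ _ _ d).
  by derive_by ltac:(rewrite qy sy; field).
have pw : perp e y w = 1.
  by rewrite /perp ew mulr0 subr0 /y dotDl dotZl ew w1; ring.
by rewrite !dF !D (perp_axis e1) e1 ew pw; split; ring.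
Qed.

(** At [y = m e + w] one has q = 1 and y - p e = w, so the third derivative of the spray along [e]
    is al3 w + be3 e; [frame_dF] pairs it with dF. *)
Lemma landsberg_eq_ppp :
  (h m - m * h' m) * al3 m + h' m * be3 m = 0.
Proof.
have [ey py ty qy sy] := frame_facts; have [dFe dFw] := frame_dF.
rewrite -(landsberg_contracted e e e ty) -dFw -dFe !mulr_suml -big_split.
apply: eq_bigr => i _ /=; rewrite -!mulrA -mulrDr; congr (_ * _).
have D3 := derive_on oT (derive_on oT (spray_De i) (fun y ty => spray_Dee i ty)) (fun y ty =>
    spray_Deee i ty).
apply/esym; apply: etrans (D3 y (mem_set ty)) _.
by rewrite qy sy ey /y !mxE; field.
Qed.

Lemma landsberg_eq_vvp v : dot v v = 1 -> dot e v = 0 -> dot w v = 0 ->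
  - m * (h m - m * h' m) * al2 m + h' m * (be1 m - m * be2 m) = 0.
Proof.
move=> v1 ev wv.
have [ey py ty qy sy] := frame_facts; have [dFe dFw] := frame_dF.
rewrite -(landsberg_contracted v v e ty) -dFw -dFe mulr_sumr !mulr_suml -big_split.
apply: eq_bigr => i _ /=.
(* The factor [perp e y v] vanishes at the point considered but not near it, and another derivative
   along [v] follows. So it is kept as a factor, and its derivative [perp e v v = 1] brings out the
   cofactor [X]. *)
pose X y := - (slope e y * al2 (slope e y) * (y 0 i - dot e y * e 0 i)) / pnorm e y ^+ 2
  + (be1 (slope e y) - slope e y * be2 (slope e y)) / pnorm e y * e 0 i.
have yv : perp e y v = 0 by rewrite /perp ev mulr0 subr0 dotDl dotZl ev wv mulr0 addr0.
have vv : perp e v v = 1 by rewrite /perp ev v1; ring.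
have D2 : {in tangential e, 'D_v ('D_e (spray F i x)) =1 fun y => perp e y v * X y + al1 (slope e
    y) * v 0 i}.
  apply: (derive_on oT (spray_De i)) => z tz; have q0 := pnorm_neq0 tz.
  have d1 := drv_pnorm v tz; have d2 := drv_slope v tz; rewrite ev in d2.
  have d3 := drv_coord z v i; have d4 := drv_dot e z v; rewrite ev in d4.
  by derive_by ltac:(rewrite /X /=; field).
have D3 : is_derive y v (fun y => perp e y v * X y + al1 (slope e y) * v 0 i) (X y).
  have q0 := pnorm_neq0 ty.
  have d1 := drv_pnorm v ty; have d2 := drv_slope v ty; rewrite ev yv in d1 d2.
  have d3 := drv_coord y v i; have d4 := drv_dot e y v; rewrite ev in d4.
  have d5 := drv_perpl e v y v; rewrite vv in d5.
  have q20 : pnorm e y ^+ 2 != 0 by rewrite expf_eq0.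
  rewrite /X; notypeclasses refine (drv_eq _ _); [drv|]; [exact: q20|exact: q0|].
  by cbv beta; rewrite yv; field.
rewrite (eq_derive_on v oT D2 (mem_set ty)) (@derive_val _ _ _ _ _ _ _ D3).
by rewrite /X qy sy ey /y !mxE; field.
Qed.

End Frame.

(** Here q al(m) = a p and q^2 be(m) = b q^2 + c p^2, and q^2 is the polynomial [perp e y y]. *)
Lemma berwald_quadratic (a b c : R) :
  (forall m, al m = a * m) -> (forall m, be m = b + c * m ^+ 2) ->
  forall y, tangential e y -> forall i j k l, berwald_curvature F i j k l x y = 0.
Proof.
move=> alE beE y ty i j k l; rewrite /berwald_curvature /partial_y.
set u := delta_mx 0 j; set v := delta_mx 0 k; set w := delta_mx 0 l.
have sE : {in tangential e, spray F i x =1 fun y =>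
    a * dot e y * (y 0 i - dot e y * e 0 i) + (b * perp e y y + c * dot e y ^+ 2) * e 0 i}.
  move=> z /[dup] /set_mem tz /sprayE ->; have q0 := pnorm_neq0 tz.
  by rewrite alE beE -pnorm_sqr // (dot_slope tz); ring.
have D1 : {in tangential e, 'D_w (spray F i x) =1 fun y =>
    a * dot e w * (y 0 i - dot e y * e 0 i) + a * dot e y * (w 0 i - dot e w * e 0 i)
    + (2 * b * perp e y w + 2 * c * dot e y * dot e w) * e 0 i}.
  apply: (derive_on oT sE) => z tz.
  have d1 := drv_coord z w i; have d2 := drv_dot e z w; have d3 := drv_perp2 e z w.
  by derive_by ltac:(rewrite /=; ring).
have D2 : {in tangential e, 'D_v ('D_w (spray F i x)) =1 fun y =>
    a * dot e w * (v 0 i - dot e v * e 0 i) + a * dot e v * (w 0 i - dot e w * e 0 i)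
    + (2 * b * perp e v w + 2 * c * dot e v * dot e w) * e 0 i}.
  apply: (derive_on oT D1) => z tz.
  have d1 := drv_coord z v i; have d2 := drv_dot e z v; have d3 := drv_perpl e w z v.
  by derive_by ltac:(rewrite /=; ring).
by rewrite (eq_derive_on u oT D2 (mem_set ty)) derive_cst.
Qed.

End LandsbergAt.

Lemma Ck_id (R : realType) k (A : set R) : Ck k A (fun x : R => x).
Proof.
case: k => [//|k]; split=> [x _|v]; first exact/derivable1_diffP.
by rewrite (_ : 'D_v _ = fun=> v); [exact: Ck_cst|apply/funext => x; rewrite derive_id].
Qed.

Lemma Ck_slice_snd (R : realType) k (A : set (R * R)) (B : set R) (G : R * R -> R) (r : R) :
  open B -> (forall m, B m -> A (r, m)) -> smooth_on A G -> Ck k B (fun m => G (r, m)).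
Proof.
move=> oB BA; elim: k G => [//|k IH] G sG.
have d m : B m -> is_derive m (1 : R) (fun m => G (r, m)) ('D_((0, 1) : R * R) G (r, m)).
  by move=> /BA Am; apply/is_derive_snd; exact: smooth_on_is_derive Am.
split=> [m Bm|v]; first by apply/derivable1_diffP; have [] := d m Bm.
apply: (eq_Ck oB (f := fun m => v * 'D_((0, 1) : R * R) G (r, m))) => [m /set_mem Bm|].
  rewrite derive_scale1; last by apply/derivable1_diffP; have [] := d m Bm.
  by have dm := d m Bm; rewrite (@derive_val _ _ _ _ _ _ _ dm).
by apply: (Ck_mul oB (Ck_cst _ _ _)); apply: (IH ('D_((0, 1) : R * R) G)); exact: smooth_on_derive.
Qed.

Lemma Ck_slice_fst (R : realType) k (A : set (R * R)) (B : set R) (G : R * R -> R) (m : R) :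
  open B -> (forall t, B t -> A (t, m)) -> smooth_on A G -> Ck k B (fun t => G (t, m)).
Proof.
move=> oB BA; elim: k G => [//|k IH] G sG.
have d t : B t -> is_derive t (1 : R) (fun t => G (t, m)) ('D_((1, 0) : R * R) G (t, m)).
  by move=> /BA Am; apply/is_derive_fst; exact: smooth_on_is_derive Am.
split=> [t Bt|v]; first by apply/derivable1_diffP; have [] := d t Bt.
apply: (eq_Ck oB (f := fun t => v * 'D_((1, 0) : R * R) G (t, m))) => [t /set_mem Bt|].
  rewrite derive_scale1; last by apply/derivable1_diffP; have [] := d t Bt.
  by have dm := d t Bt; rewrite (@derive_val _ _ _ _ _ _ _ dm).
by apply: (Ck_mul oB (Ck_cst _ _ _)); apply: (IH ('D_((1, 0) : R * R) G)); exact: smooth_on_derive.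
Qed.

Lemma Ck_derivative (R : realType) (f : R -> R) : (forall k, Ck k setT f) ->
  exists2 g : R -> R, forall m : R, is_derive m (1 : R) f (g m) & forall k, Ck k setT g.
Proof.
move=> Cf; exists ('D_(1 : R) f) => [m|k]; last exact: Ck_derive (Cf k.+1).
exact: Ck_is_derive (Cf 1) I.
Qed.

Ltac ck := first
  [ eassumption | apply: Ck_cst | apply: Ck_id
  | apply: (Ck_add openT); ck | apply: (Ck_opp openT); ck
  | apply: (Ck_exp _ openT); ck | apply: (Ck_mul openT); ck
  | apply: (Ck_inv openT); [ | ck] ].

(** * The alternative at a single radius *)

Section FixedRadius.
Variables (R : realType) (n : nat) (F : 'rV[R]_n -> 'rV[R]_n -> R) (x e : 'rV[R]_n) (r : R).
Hypotheses (n3 : (3 <= n)%N) (e1 : dot e e = 1) (r0 : r != 0).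
Variables h0 h1 h2 hr hr1 : R -> R.
Hypotheses (dh0 : forall m : R, is_derive m (1 : R) h0 (h1 m))
  (dh1 : forall m : R, is_derive m (1 : R) h1 (h2 m))
  (dhr : forall m : R, is_derive m (1 : R) hr (hr1 m)).
Hypotheses (Ch0 : forall k, Ck k setT h0) (Ch1 : forall k, Ck k setT h1)
  (Ch2 : forall k, Ck k setT h2) (Chr : forall k, Ck k setT hr) (Chr1 : forall k, Ck k setT hr1).
(** The [h] family is H(r, .) with its derivatives in m and r, the [psi] family the same for H^2;
    [theta] is the coefficient produced by the turning axis. *)
Let psi m := h0 m ^+ 2.
Let psi1 m := 2 * h0 m * h1 m.
Let psi2 m := 2 * (h1 m ^+ 2 + h0 m * h2 m).
Let psir m := 2 * h0 m * hr m.
Let psir1 m := 2 * (h1 m * hr m + h0 m * hr1 m).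
Let theta m := (psi1 m * (1 + m ^+ 2) - 2 * m * psi m) / r.
Let theta1 m := (psi2 m * (1 + m ^+ 2) - 2 * psi m) / r.
Hypothesis FE : {in tangential e, F x =1 fun y => pnorm e y * h0 (slope e y)}.
Hypothesis dxF : forall v, {in tangential e, (fun y => 'D_v (fun x => sqF F x y) x) =1
  fun y => pnorm e y ^+ 2 * psir (slope e y) * dot e v
           + pnorm e y * theta (slope e y) * perp e y v}.
Hypothesis regular : forall y, tangential e y -> 0 < F x y /\ posdef (metric_tensor F x y).
Hypothesis landsberg : forall y, tangential e y ->
  forall j k l, landsberg_curvature F j k l x y = 0.

Let dpsi m : is_derive m (1 : R) psi (psi1 m).
Proof. by rewrite /psi; derive_by ltac:(rewrite /psi1 /=; ring). Qed.
Let dpsi1 m : is_derive m (1 : R) psi1 (psi2 m).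
Proof. by rewrite /psi1; derive_by ltac:(rewrite /psi2; ring). Qed.
Let dpsir m : is_derive m (1 : R) psir (psir1 m).
Proof. by rewrite /psir; derive_by ltac:(rewrite /psir1; ring). Qed.
Let dtheta m : is_derive m (1 : R) theta (theta1 m).
Proof.
have d1 := dpsi; have d2 := dpsi1.
by rewrite /theta; derive_by ltac:(rewrite /theta1 /psi2 /psi1 /psi /=; field).
Qed.

Let sqFE : {in tangential e, sqF F x =1 fun y => pnorm e y ^+ 2 * psi (slope e y)}.
Proof. by move=> y /FE; rewrite /sqF => ->; rewrite /psi exprMn. Qed.

Lemma fixed_radius_pos m : [/\ 0 < h0 m, 0 < h0 m - m * h1 m & 0 < h2 m].
Proof.
have [w [w1 ew _]] := exists_orthogonal_unit e e n3.
have [v [v1 ev wv]] := exists_orthogonal_unit e w n3.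
have [ey py ty qy sy] := frame_facts e1 m w1 ew.
set y := m *: e + w in ey py ty qy sy.
have [F0 pg] := regular ty.
have h0_gt0 : 0 < h0 m by move: F0; rewrite FE ?inE // qy sy mul1r.
have hessE u : (u *m metric_tensor F x y *m u^T) 0 0 = 2^-1 * energy_hess e psi psi1 psi2 u u y.
  exact: (metric_tensor_quad dpsi dpsi1 sqFE).
have yv : perp e y v = 0 by rewrite /perp ev mulr0 subr0 dotDl dotZl ev wv mulr0 addr0.
have vv : perp e v v = 1 by rewrite /perp ev v1; ring.
(* On [v], orthogonal to both [e] and [y], the metric is F (H - m H'). *)
have N0 : 0 < h0 m - m * h1 m.
  have v0 : v != 0 by rewrite -dot_gt0 v1.
  have := pg v v0; rewrite hessE /energy_hess sy qy yv ev vv.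
  have -> : 2^-1 * ((2 * psi m - m * psi1 m) * 1 + (psi1 m - m * psi2 m) * (0 - m * (0 / 1)) * (0
      / 1)
    + (psi1 m * (0 / 1) + psi2 m * (0 - m * (0 / 1))) * 0) = h0 m * (h0 m - m * h1 m).
    by rewrite /psi /psi1; field.
  by rewrite pmulr_rgt0.
(* This [u] is tangent to the indicatrix, dF(u) = 0, so the metric on it reduces to F times the
   Hessian of F. The slope changes at rate [h0] along [u], which gives h0 * (h0^2 * h2). *)
split=> //; pose u := (h0 m - m * h1 m) *: e - h1 m *: w.
have eu : dot e u = h0 m - m * h1 m by rewrite dotDr dotNr !dotZr e1 ew; ring.
have wu : dot w u = - h1 m by rewrite dotDr dotNr !dotZr (dotC w) ew w1; ring.
have yu : perp e y u = - h1 m by rewrite /perp dotDl dotZl ey eu wu; ring.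
have uu : perp e u u = h1 m ^+ 2.
  by rewrite /perp eu {1}/u dotDl dotNl !dotZl eu wu; ring.
have u0 : u != 0.
  by apply/eqP => u0; move: eu N0; rewrite u0 dot0r => <-; rewrite ltxx.
have := pg u u0; rewrite hessE /energy_hess sy qy yu eu uu.
have -> : 2^-1 * ((2 * psi m - m * psi1 m) * h1 m ^+ 2
  + (psi1 m - m * psi2 m) * (h0 m - m * h1 m - m * (- h1 m / 1)) * (- h1 m / 1)
  + (psi1 m * (- h1 m / 1) + psi2 m * (h0 m - m * h1 m - m * (- h1 m / 1))) * (h0 m - m * h1 m))
  = h0 m ^+ 3 * h2 m by rewrite /psi /psi1 /psi2; field.
by rewrite pmulr_rgt0 // exprn_gt0.
Qed.

Let N m := h0 m - m * h1 m.
(** The equations of [spray_polar] form a linear system for [be] and [al], solved by Cramer's rule: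
    psi1^2 - 2 psi psi2 = - D. *)
Let D m := 4 * h0 m ^+ 3 * h2 m.
Let d m := m * psir m + theta m.
Let k m := m * psir1 m - psir m + theta1 m.
Let be m := ((2 * psi m - m * psi1 m) * k m - (psi1 m - m * psi2 m) * d m) * (2 * D m)^-1.
Let al m := (psi2 m * d m - psi1 m * k m) * (2 * D m)^-1.

Let D0 m : D m != 0.
Proof.
have [h_gt0 _ h2_gt0] := fixed_radius_pos m.
by rewrite gt_eqF // !mulr_gt0 // exprn_gt0.
Qed.

Let Ck_coefs j : Ck j setT be /\ Ck j setT al.
Proof.
have C0 := Ch0 j; have C1 := Ch1 j; have C2 := Ch2 j; have Cr := Chr j; have Cr1 := Chr1 j.
have Cp : Ck j setT psi by rewrite /psi; ck.
have Cp1 : Ck j setT psi1 by rewrite /psi1; ck.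
have Cp2 : Ck j setT psi2 by rewrite /psi2; ck.
have Cpr : Ck j setT psir by rewrite /psir; ck.
have Cpr1 : Ck j setT psir1 by rewrite /psir1; ck.
have Ct : Ck j setT theta by rewrite /theta; ck.
have Ct1 : Ck j setT theta1 by rewrite /theta1; ck.
have Cd : Ck j setT d by rewrite /d; ck.
have Ckk : Ck j setT k by rewrite /k; ck.
have CD : Ck j setT (fun m => (2 * D m)^-1).
  apply: (Ck_inv openT) => [m _|]; first by rewrite mulf_neq0 // pnatr_eq0.
  by rewrite /D; ck.
by split; [rewrite /be|rewrite /al]; ck.
Qed.

Let eqA m : 2 * (psi1 m * be m + (2 * psi m - m * psi1 m) * al m) = d m.
Proof.
have [/lt0r_neq0 h0n _ /lt0r_neq0 h2n] := fixed_radius_pos m.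
rewrite /be /al /D; move: (d m) (k m) => dm km; rewrite /psi2 /psi1 /psi; field.
by rewrite h0n h2n.
Qed.

Let eqB m : 2 * (psi2 m * be m + (psi1 m - m * psi2 m) * al m) = k m.
Proof.
have [/lt0r_neq0 h0n _ /lt0r_neq0 h2n] := fixed_radius_pos m.
rewrite /be /al /D; move: (d m) (k m) => dm km; rewrite /psi2 /psi1 /psi; field.
by rewrite h0n h2n.
Qed.

Let sprayE i : {in tangential e, spray F i x =1 fun y =>
  pnorm e y * al (slope e y) * (y 0 i - dot e y * e 0 i)
  + pnorm e y ^+ 2 * be (slope e y) * e 0 i}.
Proof.
move=> y /set_mem ty; have [_ pg] := regular ty.
exact: (spray_polar e1 dpsi dpsi1 dpsir dtheta sqFE dxF ty pg (eqA _) (eqB _)).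
Qed.

Lemma fixed_radius_dichotomy :
  (exists a c, forall m, hr m = a * h0 m + c * m * h1 m) /\
  ((exists a b, forall m, h1 m = (a * m + b) * (h0 m - m * h1 m)) \/
   forall y, tangential e y -> forall i j k l, berwald_curvature F i j k l x y = 0).
Proof.
have Cal j := (Ck_coefs j).2; have Cbe j := (Ck_coefs j).1.
have [al1 dal Cal1] := Ck_derivative Cal.
have [al2 dal1 Cal2] := Ck_derivative Cal1.
have [al3 dal2 Cal3] := Ck_derivative Cal2.
have [be1 dbe Cbe1] := Ck_derivative Cbe.
have [be2 dbe1 Cbe2] := Ck_derivative Cbe1.
have [be3 dbe2 Cbe3] := Ck_derivative Cbe2.
have [be4 dbe3 Cbe4] := Ck_derivative Cbe3.
have pos m := fixed_radius_pos m.
have h0n m : h0 m != 0 by rewrite gt_eqF //; have [] := pos m.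
have h20 m : 2 * h0 m != 0 by rewrite mulf_neq0 // pnatr_eq0.
have Nn m : N m != 0 by rewrite gt_eqF // /N; have [] := pos m.
have landsberg' y (ty : tangential e y) := conj (regular ty).1 (landsberg ty).
have eq_ppp m : N m * al3 m + h1 m * be3 m = 0.
  have [w [w1 ew _]] := exists_orthogonal_unit e e n3.
  exact: (landsberg_eq_ppp e1 (Ch0 1) dh0 dal dal1 dal2 dbe dbe1 dbe2 Cal Cbe FE sprayE
      landsberg' m w1 ew).
have eq_vvp m : - m * N m * al2 m + h1 m * (be1 m - m * be2 m) = 0.
  have [w [w1 ew _]] := exists_orthogonal_unit e e n3.
  have [v [v1 ev wv]] := exists_orthogonal_unit e w n3.
  exact: (landsberg_eq_vvp e1 (Ch0 1) dh0 dal dal1 dal2 dbe dbe1 dbe2 Cal Cbe FE sprayE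
      landsberg' m w1 ew v1 ev wv).
(* The derivative of [eqA] minus [eqB]: the terms with undifferentiated [al] and [be] cancel. The
   result is horizontal constancy of F along the axis. *)
have eqC m : hr m = h1 m * be1 m + N m * al1 m.
  have d1 : is_derive m (1 : R) (fun m => 2 * (psi1 m * be m + (2 * psi m - m * psi1 m) * al m))
     (2 * (psi2 m * be m + psi1 m * be1 m + (psi1 m - m * psi2 m) * al m + (2 * psi m - m * psi1
        m) * al1 m)).
    have p1 := dpsi m; have p2 := dpsi1 m; have a1 := dal m; have b1 := dbe m.
    move: p1 p2 a1 b1; move: psi psi1 psi2 al be => p p1 p2 a b dp dp1 da db.
    by derive_by ltac:(ring).
  have d2 : is_derive m (1 : R) d (k m + 2 * psir m).
    have p1 := dpsir m; have p2 := dtheta m; rewrite /d /k.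
    move: p1 p2; move: psir psir1 theta theta1 => p p1 t t1 dp dt.
    by derive_by ltac:(ring).
  have := eq_derive_val eqA d1 d2; rewrite -eqB => E.
  have {}E : 2 * h0 m * (h1 m * be1 m + N m * al1 m) = 2 * h0 m * hr m.
    have E2 : psi1 m * be1 m + (2 * psi m - m * psi1 m) * al1 m = psir m.
      move: E; move: (psi m) (psi1 m) (psi2 m) (psir m) (al m) (be m) => p p1 p2 pr a b; lra.
    by rewrite -[RHS]/(psir m) -E2 /psi1 /psi /N; ring.
  by apply/esym/(mulfI (h20 m)).
pose tau m := h1 m / N m.
(* Since N' = - m h2, tau' = h2 (N + m h1) / N^2, and N + m h1 = h0. *)
pose tau1 m := h0 m * h2 m / N m ^+ 2.
have dtau m : is_derive m (1 : R) tau (tau1 m).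
  have Nm := Nn m; rewrite /tau /N in Nm *.
  notypeclasses refine (drv_eq _ _); [drv|]; first exact: Nm.
  by rewrite /tau1 /N; cbv beta; field.
have Ctau1 j : Ck j setT tau1.
  have C0 := Ch0 j; have C1 := Ch1 j; have C2 := Ch2 j.
  have CN : Ck j setT (fun m => (N m ^+ 2)^-1).
    apply: (Ck_inv openT) => [m _|]; first by rewrite expf_eq0 /= Nn.
    by rewrite /N; ck.
  by rewrite /tau1; ck.
have [tau2 dtau1 _] := Ck_derivative Ctau1.
have tau1_gt0 m : 0 < tau1 m.
  by have [? ? ?] := pos m; rewrite /tau1 divr_gt0 ?mulr_gt0 ?exprn_gt0.
have tau_ppp m : tau m * be3 m + al3 m = 0.
  apply: (mulfI (Nn m)); rewrite mulr0 -(eq_ppp m) /tau; field; exact: Nn.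
have tau_vvp m : tau m * (be1 m - m * be2 m) = m * al2 m.
  apply: (mulfI (Nn m)); have := eq_vvp m; rewrite /tau => E.
  transitivity (h1 m * (be1 m - m * be2 m)); first by field; exact: Nn.
  by move/eqP: E; rewrite addrC addr_eq0 => /eqP ->; ring.
(* [eqA] with [hr] eliminated by [eqC]; the factor 1/r comes from [theta]. *)
have horizontal m : tau m * (r^-1 - 2 * be m + m * be1 m) = r^-1 * m + 2 * al m - m * al1 m.
  have E := eqA m; rewrite /d /psir eqC in E.
  have E2 : theta m = 2 * h0 m * (h1 m * (2 * be m - m * be1 m) + N m * (2 * al m - m * al1 m)).
    by move: E; rewrite /psi1 /psi /N => E; rewrite -[LHS](addKr (m * (2 * h0 m * (h1 m * be1 m +
        (h0 m - m * h1 m) * al1 m)))) -E; ring.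
  have E3 : (h1 m - m * N m) / r = h1 m * (2 * be m - m * be1 m) + N m * (2 * al m - m * al1 m).
    apply: (mulfI (h20 m)); rewrite -E2 /theta /psi1 /psi /N.
    by field.
  apply: (mulfI (Nn m)); transitivity (h1 m * (r^-1 - 2 * be m + m * be1 m)).
    by rewrite /tau; field; rewrite ?r0 ?Nn.
  have -> : h1 m * (r^-1 - 2 * be m + m * be1 m) = (h1 m - m * N m) / r
      - h1 m * (2 * be m - m * be1 m) + N m * (r^-1 * m) by ring.
  by rewrite E3; ring.
have alE := landsberg_alpha dtau dtau1 dal dal1 dal2 dbe dbe1 dbe2 horizontal tau_ppp tau_vvp
    tau1_gt0.
have beE := landsberg_beta dtau dtau1 dal dal1 dal2 dbe dbe1 dbe2 dbe3 horizontal tau_ppp tau_vvp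
    tau1_gt0.
have be1E := landsberg_beta1 dtau dtau1 dal dal1 dal2 dbe dbe1 dbe2 dbe3 horizontal tau_ppp
    tau_vvp tau1_gt0.
split.
  (* Insert [be1 m = be2 0 * m] and the constant [al1] into [eqC], with N = h0 - m h1. *)
  exists (al1 0), (be2 0 - al1 0) => m; rewrite eqC be1E.
  have -> : al1 m = al1 0.
    have := is_derive_unique (dal m) _; apply.
    have -> : al = fun m => al 0 + al1 0 * m by apply/funext.
    by derive_by ltac:(ring).
  by rewrite /N; ring.
have [E0|E0] := eqVneq (r^-1 - 2 * be 0) 0.
  right; apply: (berwald_quadratic sprayE (a := al1 0) (b := be 0) (c := be2 0 / 2)) => m.
    by rewrite alE (landsberg_alpha0 horizontal E0) add0r.
  exact: beE.
left; exists (tau1 0), (tau 0) => m.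
have tE := landsberg_tau_affine dtau dtau1 dal dal1 dal2 dbe dbe1 dbe2 dbe3 horizontal tau_ppp
    tau_vvp tau1_gt0 m E0.
by rewrite [tau1 0 * m + _]addrC -tE /tau -/(N m) divfK.
Qed.
End FixedRadius.

(** * Dependence on the radius *)

Lemma axisZ (R : realType) n (t : R) (e : 'rV[R]_n) : 0 < t -> dot e e = 1 -> axis (t *: e) = e.
Proof.
move=> t0 e1; rewrite /axis enormZ ?ltW // /enorm e1 sqrtr1 mulr1 scalerA mulVf ?scale1r //.
by rewrite gt_eqF.
Qed.

Lemma enorm_unit (R : realType) n (e : 'rV[R]_n) : dot e e = 1 -> enorm e = 1.
Proof. by rewrite /enorm => ->; rewrite sqrtr1. Qed.

Lemma axisK (R : realType) n (x : 'rV[R]_n) : x != 0 -> enorm x *: axis x = x.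
Proof. by move=> x0; rewrite scalerA divff ?scale1r // gt_eqF // enorm_gt0. Qed.

Section Radii.
Variables (R : realType) (n : nat) (Omega : set 'rV[R]_n).

Lemma radii_gt0 r : radii Omega r -> 0 < r.
Proof. by move=> [x [_ x0 <-]]; rewrite enorm_gt0. Qed.

Lemma radii_enorm x : Omega x -> x != 0 -> radii Omega (enorm x).
Proof. by move=> Ox x0; exists x. Qed.

Lemma open_ray (e : 'rV[R]_n) : open Omega -> open [set t : R | Omega (t *: e)].
Proof.
move=> oO; apply: (@open_comp _ _ (fun t : R => t *: e) Omega) => // t _.
exact: scalel_continuous.
Qed.

Lemma open_radii : open Omega -> open (radii Omega).
Proof.
move=> oO; rewrite openE => r [x [Ox x0 xr]]; rewrite /interior.
have r0 : 0 < r by rewrite -xr enorm_gt0.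
have e1 := axis_unit x0.
have : nbhs r ([set t : R | Omega (t *: axis x)] `&` [set t | 0 < t]).
  apply: filterI; apply: open_nbhs_nbhs; split;
    [exact: open_ray|by rewrite /= -xr axisK|exact: open_gt|exact: r0].
apply: filterS => t [Ot t0]; exists (t *: axis x); split => //.
  by rewrite scaler_eq0 negb_or gt_eqF //= -dot_eq0 e1 oner_eq0.
by rewrite enormZ ?ltW // enorm_unit ?mulr1.
Qed.

Lemma open_radii_plane : open Omega -> open (radii Omega `*` setT : set (R * R)).
Proof.
move=> oO; rewrite (_ : _ `*` _ = fst @^-1` radii Omega).
  by apply: open_comp => [p _|]; [exact: cvg_fst|exact: open_radii].
by apply/seteqP; split=> [p []|p].
Qed.

(** The norms of a connected set form an interval, and [t >= r1 > 0] keeps the origin out even if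
    [Omega] contains it. *)
Lemma radii_interval r1 r2 t : is_domain Omega -> radii Omega r1 -> radii Omega r2 ->
  r1 <= t <= r2 -> radii Omega t.
Proof.
move=> [_ cO _] R1 R2 rt.
have /connected_intervalP itv : connected (@enorm R n @` Omega).
  apply: connected_continuous_connected => //; apply: continuous_subspaceT.
  exact: continuous_enorm.
have r10 := radii_gt0 R1; have [x1 [Ox1 x10 xr1]] := R1.
have [x2 [Ox2 x20 xr2]] := R2.
have [x Ox xt] : (@enorm R n @` Omega) t.
  by apply: itv rt; [exists x1|exists x2].
exists x; split=> //; rewrite -enorm_gt0 xt; case/andP: rt => r1t _.
exact: lt_le_trans r1t.
Qed.

End Radii.

Section Profile.
Variables (R : realType) (n : nat) (Omega : set 'rV[R]_n) (F : 'rV[R]_n -> 'rV[R]_n -> R).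
Hypotheses (n3 : (3 <= n)%N) (oO : open Omega).
Variable phi : R -> R -> R.
Hypothesis FE : forall x y, Omega x -> y != 0 -> F x y = enorm y * phi (enorm x) (dot x y / enorm
    y).
Hypothesis smoothF : smooth_on [set p : 'rV[R]_n * 'rV[R]_n | Omega p.1 /\ nonradial p.1 p.2]
    (fun p => F p.1 p.2).

(* [profile (r, m)] is F at y = m e + w, for x = r e and e, w orthonormal. *)
Definition profile (p : R * R) : R :=
  Num.sqrt (p.2 ^+ 2 + 1) * phi p.1 (p.1 * p.2 / Num.sqrt (p.2 ^+ 2 + 1)).

Lemma F_profile x y : Omega x -> nonradial x y ->
  F x y = pnorm (axis x) y * profile (enorm x, slope (axis x) y).
Proof.
move=> Ox /nonradialP [x0 ty]; have q0 := pnorm_gt0 ty.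
have r0 : 0 < enorm x by rewrite enorm_gt0.
set q := pnorm _ y in q0 *; set m := slope _ y.
have yE : enorm y = q * Num.sqrt (m ^+ 2 + 1).
  apply/eqP; rewrite -(eqrXn2 (n := 2)) ?mulr_ge0 ?enorm_ge0 ?sqrtr_ge0 ?ltW //.
  have es : Num.sqrt (m ^+ 2 + 1) ^+ 2 = m ^+ 2 + 1 by rewrite sqr_sqrtr ?addr_ge0 ?sqr_ge0.
  rewrite exprMn enorm_sqr es /q pnorm_sqr // mulrDr mulr1 -{1}pnorm_sqr // -exprMn mulrC.
  by rewrite -/q mulrC [q * m]mulrC -dot_slope // /perp -expr2 addrC subrK.
have y0 : y != 0.
  apply/eqP => y0; move: ty; rewrite /tangential /= y0 /perp !dot0r mul0r subr0.
  by rewrite ltxx.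
rewrite FE // yE /profile /= -/m (mulrA q); congr (_ * phi _ _).
have -> : dot x y = enorm x * m * q.
  by rewrite -mulrA -dot_slope // dot_axis mulrCA divff ?mulr1 // gt_eqF.
by rewrite (mulrC q) -mulf_div divff ?mulr1 // gt_eqF.
Qed.

(** Smoothness is inherited from F along the affine map (r, m) -> (r e, m e + w). As [Omega] need
    not be rotation invariant, [e] is the axis of some point of [Omega] at the given radius, and the
    argument is local in r. *)
Lemma smooth_profile : smooth_on (radii Omega `*` setT) profile.
Proof.
apply: smooth_on_local => -[r m] [/= [x [Ox x0 xr]] _].
have e1 := axis_unit x0; set e := axis x in e1.
have [w [w1 ew _]] := exists_orthogonal_unit e e n3.
pose B := [set p : R * R | Omega (p.1 *: e) /\ 0 < p.1].
have oB : open B.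
  rewrite (_ : B = fst @^-1` ([set t : R | Omega (t *: e)] `&` [set t | 0 < t])) //.
  apply: open_comp => [p _|]; first exact: cvg_fst.
  by apply: openI; [exact: open_ray|exact: open_gt].
exists B; first by rewrite /B /= -xr axisK // enorm_gt0.
have lin : linear (fun p : R * R => (p.1 *: e, p.2 *: e)).
  by move=> a [u1 u2] [v1 v2] /=; rewrite !scalerDl -!scalerA.
pose l : {linear (R * R)%type -> ('rV[R]_n * 'rV[R]_n)%type} :=
  HB.pack (fun p : R * R => (p.1 *: e, p.2 *: e)) (GRing.isLinear.Build _ _ _ _ _ lin).
have frame (t m' : R) : 0 < t -> nonradial (t *: e) (m' *: e + w).
  move=> t0; apply/nonradialP; rewrite axisZ //.
  have [_ _ ? _ _] := frame_facts e1 m' w1 ew; split=> //.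
  by rewrite scaler_eq0 negb_or gt_eqF //= -dot_eq0 e1 oner_eq0.
apply: (eq_smooth_on (f := fun p => (fun q => F q.1 q.2) (l p + (0, w))) oB).
  move=> [t m'] /set_mem [/= Ot t0]; rewrite addr0 F_profile //; last exact: frame.
  have [_ _ _ qy sy] := frame_facts e1 m' w1 ew.
  by rewrite axisZ // qy sy mul1r enormZ ?ltW // enorm_unit // mulr1.
apply: smooth_on_affine smoothF.
- move=> p; change ((fun p : R * R => (p.1 *: e, p.2 *: e)) @ p --> (p.1 *: e, p.2 *: e)).
  have c1 : (q.1 *: e) @[q --> p] --> p.1 *: e by apply: cvgZr_tmp; exact: cvg_fst.
  have c2 : (q.2 *: e) @[q --> p] --> p.2 *: e by apply: cvgZr_tmp; exact: cvg_snd.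
  exact: cvg_pair c1 c2.
- by move=> [t m'] [/= Ot t0]; rewrite addr0; split=> //; exact: frame.
Qed.

End Profile.

Section SmoothSchwarz.
Variables (R : realType) (A : set (R * R)).
Hypothesis oA : open A.
Local Notation Dfst f := ('D_((1, 0) : R * R) f).
Local Notation Dsnd f := ('D_((0, 1) : R * R) f).

Lemma smooth_schwarz f : smooth_on A f -> {in A, Dsnd (Dfst f) =1 Dfst (Dsnd f)}.
Proof.
move=> sf p /set_mem Ap.
have s1 := smooth_on_derive ((1, 0) : R * R) sf; have s2 := smooth_on_derive ((0, 1) : R * R) sf.
have s12 := smooth_on_derive ((0, 1) : R * R) s1; have s21 := smooth_on_derive ((1, 0) : R * R) s2.
apply: (@schwarz R f (Dfst f) (Dsnd f) (Dsnd (Dfst f)) (Dfst (Dsnd f)) A p oA Ap).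
- by move=> q Aq; exact: smooth_on_is_derive sf Aq.
- by move=> q Aq; exact: smooth_on_is_derive sf Aq.
- by move=> q Aq; exact: smooth_on_is_derive s1 Aq.
- by move=> q Aq; exact: smooth_on_is_derive s2 Aq.
- exact: smooth_on_continuous s12 Ap.
- exact: smooth_on_continuous s21 Ap.
Qed.

(** Needed to obtain the evolution of H''(r, 0) in r from the transport equation for H_r. *)
Lemma smooth_schwarz2 f p : smooth_on A f -> A p ->
  is_derive p ((1, 0) : R * R) (Dsnd (Dsnd f)) (Dsnd (Dsnd (Dfst f)) p).
Proof.
move=> sf Ap; have s2 := smooth_on_derive ((0, 1) : R * R) sf.
have s22 := smooth_on_derive ((0, 1) : R * R) s2.
rewrite (eq_derive_on _ oA (smooth_schwarz sf) (mem_set Ap)) (smooth_schwarz s2 (mem_set Ap)).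
exact: smooth_on_is_derive s22 Ap.
Qed.

End SmoothSchwarz.

Lemma derive0_itv_cst (R : realType) (f : R -> R) (a b : R) : a <= b ->
  (forall t, a <= t <= b -> is_derive t (1 : R) f 0) -> f a = f b.
Proof.
move=> ab df; apply/eqP; rewrite eq_sym -subr_eq0; apply/eqP.
have [|| _ _ ->] := @MVT_segment R f (fun=> 0) a b ab; last by rewrite mul0r.
- by move=> t; rewrite in_itv /= => /andP[at' tb]; apply: df; rewrite !ltW.
- apply: derivable_within_continuous => t; rewrite in_itv /= => /df []; by [].
Qed.

(** * Transport of the profile from one radius to another *)

Section Evolution.
Variables (R : realType) (I : set R) (H Hr Hm Hmm Hrm Hrmm : R * R -> R).
Let A : set (R * R) := I `*` setT.
Hypotheses (oI : open I)
  (itvI : forall r1 r2 t, I r1 -> I r2 -> r1 <= t <= r2 -> I t).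
Hypotheses (dHr : forall p, A p -> is_derive p ((1, 0) : R * R) H (Hr p))
  (cHr : forall p, A p -> {for p, continuous Hr})
  (dHm : forall p, A p -> is_derive p ((0, 1) : R * R) H (Hm p))
  (dHmm : forall p, A p -> is_derive p ((0, 1) : R * R) Hm (Hmm p))
  (dHrm : forall p, A p -> is_derive p ((0, 1) : R * R) Hr (Hrm p))
  (dHrmm : forall p, A p -> is_derive p ((0, 1) : R * R) Hrm (Hrmm p))
  (dHmmr : forall p, A p -> is_derive p ((1, 0) : R * R) Hmm (Hrmm p)).
Hypothesis Hmm_derivable : forall p, A p -> exists l, is_derive p ((0, 1) : R * R) Hmm l.
Hypotheses (H_gt0 : forall r m, I r -> 0 < H (r, m)) (Hmm_gt0 : forall r m, I r -> 0 < Hmm (r, m)).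
Hypothesis transport : forall r, I r -> exists a c, forall m, Hr (r, m) = a * H (r, m) + c * m *
    Hm (r, m).

Definition curvature_ratio (r : R) := Hmm (r, 0) / H (r, 0).
Let nu r := Num.sqrt (curvature_ratio r).

Let nu_gt0 r : I r -> 0 < nu r.
Proof. by move=> Ir; rewrite sqrtr_gt0 divr_gt0 ?H_gt0 ?Hmm_gt0. Qed.

(** At the given radius nu' = c nu, so along m = mu / nu the motion of m cancels the term c m H_m.
    Then H(t, mu / nu t) and H(t, 0) have the same logarithmic derivative a. *)
Let rescaled_cst mu r : I r ->
  is_derive r (1 : R) (fun t => H (t, mu / nu t) / H (t, 0)) 0.
Proof.
move=> Ir; have [a [c E]] := transport Ir.
have oA : open A.
  rewrite (_ : A = fst @^-1` I); first by apply: open_comp => // p _; exact: cvg_fst.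
  by apply/seteqP; split=> [p []|p].
have Ap m : A (r, m) by [].
have h0n m : H (r, m) != 0 by rewrite gt_eqF ?H_gt0.
have d0 m : is_derive m (1 : R) (fun m => H (r, m)) (Hm (r, m)) by apply/is_derive_snd/dHm.
have d1 m : is_derive m (1 : R) (fun m => Hm (r, m)) (Hmm (r, m)) by apply/is_derive_snd/dHmm.
have Hrm_E m : Hrm (r, m) = a * Hm (r, m) + c * Hm (r, m) + c * m * Hmm (r, m).
  have e1 : is_derive m (1 : R) (fun m => Hr (r, m)) (Hrm (r, m)) by apply/is_derive_snd/dHrm.
  have dm0 := d0 m; have dm1 := d1 m.
  have e2 : is_derive m (1 : R) (fun m => a * H (r, m) + c * m * Hm (r, m))
    (a * Hm (r, m) + c * Hm (r, m) + c * m * Hmm (r, m)) by derive_by ltac:(ring).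
  exact: eq_derive_val E e1 e2.
have Hrmm_E : Hrmm (r, 0) = (a + 2 * c) * Hmm (r, 0).
  have e1 : is_derive 0 (1 : R) (fun m => Hrm (r, m)) (Hrmm (r, 0)) by apply/is_derive_snd/dHrmm.
  have [l /is_derive_snd d2] := Hmm_derivable (Ap 0).
  have dm1 := d1 0.
  have e2 : is_derive 0 (1 : R) (fun m => a * Hm (r, m) + c * Hm (r, m) + c * m * Hmm (r, m))
    ((a + 2 * c) * Hmm (r, 0)) by derive_by ltac:(ring).
  exact: eq_derive_val Hrm_E e1 e2.
have f0 : is_derive r (1 : R) (fun t => H (t, 0)) (a * H (r, 0)).
  have -> : a * H (r, 0) = Hr (r, 0) by rewrite E mulr0 mul0r addr0.
  by apply/is_derive_fst/dHr.
have f2 : is_derive r (1 : R) (fun t => Hmm (t, 0)) ((a + 2 * c) * Hmm (r, 0)).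
  by rewrite -Hrmm_E; apply/is_derive_fst/dHmmr.
have fn : is_derive r (1 : R) curvature_ratio (2 * c * curvature_ratio r).
  have h00 := h0n 0; rewrite /curvature_ratio.
  notypeclasses refine (drv_eq (drv_mul f2 (drv_inv _ f0)) _); first exact: h00.
  by field.
have n0 : 0 < curvature_ratio r by rewrite divr_gt0 ?H_gt0 ?Hmm_gt0.
have fnu : is_derive r (1 : R) nu (c * nu r).
  apply: drv_eq (drv_sqrt n0 fn) _.
  rewrite -{2}[curvature_ratio r]sqr_sqrtr ?ltW // -/(nu r); field.
  by rewrite gt_eqF ?nu_gt0.
have nun : nu r != 0 by rewrite gt_eqF ?nu_gt0.
have fmu : is_derive r (1 : R) (fun t => mu / nu t) (- (c * (mu / nu r))).
  notypeclasses refine (drv_eq (drv_mul (drv_cst r (1 : R) mu) (drv_inv _ fnu)) _); first exact: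
      nun.
  by field.
have fH := is_derive_pair (a := fun t : R => t) (b := fun t => mu / nu t) oA (Ap _) dHr (cHr (Ap _))
  (dHm (Ap _)) (drv_id r (1 : R)) fmu.
notypeclasses refine (drv_eq (drv_mul fH (drv_inv _ f0)) _); first exact: h0n.
by rewrite E; field; rewrite ?h0n ?nun.
Qed.

Lemma rescaling r1 r : I r1 -> I r -> exists C k, forall m, H (r, m) = C * H (r1, k * m).
Proof.
move=> I1 Ir.
have J mu : H (r, mu / nu r) / H (r, 0) = H (r1, mu / nu r1) / H (r1, 0).
  wlog le : r1 r I1 Ir / r1 <= r.
    by move=> W; case: (leP r1 r) => [|/ltW] le; [exact: W|apply/esym; exact: W].
  apply/esym/(derive0_itv_cst (f := fun t => H (t, mu / nu t) / H (t, 0)) le) => t rt.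
  by apply: rescaled_cst; exact: itvI rt.
exists (H (r, 0) / H (r1, 0)), (nu r / nu r1) => m.
have nr : nu r != 0 by rewrite gt_eqF ?nu_gt0.
have h0 : H (r, 0) != 0 by rewrite gt_eqF ?H_gt0.
have := J (nu r * m); rewrite mulrAC divff // mul1r => E.
by rewrite [nu r / _ * m]mulrAC -[LHS](divfK h0) E mulrC mulrA [LHS]mulrAC.
Qed.

(** The relation survives H -> C H(k m), with [a], [b] replaced by k^2 a, k b. *)
Lemma affine_propagates r1 r : I r1 -> I r ->
  (exists a b, forall m, Hm (r1, m) = (a * m + b) * (H (r1, m) - m * Hm (r1, m))) ->
  exists a b, forall m, Hm (r, m) = (a * m + b) * (H (r, m) - m * Hm (r, m)).
Proof.
move=> I1 Ir [a [b E]]; have [C [k HE]] := rescaling I1 Ir.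
have HmE m : Hm (r, m) = C * k * Hm (r1, k * m).
  have d1 : is_derive m (1 : R) (fun m => H (r, m)) (Hm (r, m)) by apply/is_derive_snd/dHm.
  have dk : is_derive (k * m) (1 : R) (fun m => H (r1, m)) (Hm (r1, k * m)) by
      apply/is_derive_snd/dHm.
  have dl : is_derive m (1 : R) (fun m => k * m) k by derive_by ltac:(ring).
  have d2 : is_derive m (1 : R) (fun m => C * H (r1, k * m)) (C * k * Hm (r1, k * m)).
    have dc := drv_comp dk dl.
    notypeclasses refine (drv_eq (drv_mul (drv_cst m (1 : R) C) dc) _).
    by cbv beta; ring.
  exact: eq_derive_val HE d1 d2.
exists (k ^+ 2 * a), (k * b) => m; rewrite HmE HE {1}E; ring.
Qed.

(** The relation and its derivative at m = 0 identify [b] and [a]. In this form they are visibly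
    smooth in r, which their mere existence at each radius does not give. *)
Lemma affine_coefficients r : I r ->
  (exists a b, forall m, Hm (r, m) = (a * m + b) * (H (r, m) - m * Hm (r, m))) ->
  forall m, Hm (r, m) = (Hmm (r, 0) / H (r, 0) * m + Hm (r, 0) / H (r, 0)) * (H (r, m) - m * Hm
      (r, m)).
Proof.
move=> Ir [a [b E]] m.
have h0 : H (r, 0) != 0 by rewrite gt_eqF ?H_gt0.
have -> : Hm (r, 0) / H (r, 0) = b.
  by rewrite E mulr0 add0r mul0r subr0 mulfK.
suff -> : Hmm (r, 0) / H (r, 0) = a by exact: E.
have d0 : is_derive 0 (1 : R) (fun m => H (r, m)) (Hm (r, 0)) by apply/is_derive_snd/dHm.
have d1 : is_derive 0 (1 : R) (fun m => Hm (r, m)) (Hmm (r, 0)) by apply/is_derive_snd/dHmm.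
have d2 : is_derive 0 (1 : R) (fun m => (a * m + b) * (H (r, m) - m * Hm (r, m))) (a * H (r, 0)).
  by derive_by ltac:(ring).
by rewrite (eq_derive_val E d1 d2) mulfK.
Qed.

End Evolution.

(** * The explicit antiderivative *)

Section Potential.
Variables (R : realType) (r a b : R) (h h' : R -> R).
Hypotheses (r0 : 0 < r) (dh : forall m : R, is_derive m (1 : R) h (h' m)) (h_gt0 : forall m, 0 <
    h m)
  (N_gt0 : forall m, 0 < h m - m * h' m)
  (affine : forall m, h' m = (a * m + b) * (h m - m * h' m)).

Let rho s := Num.sqrt (r ^+ 2 - s ^+ 2).
Let numer s := ((a - 1) / r ^+ 2 + 2 * 0) * r ^+ 2 * s + 2 * (b / 2) * rho s.
Let denom s := r ^+ 2 + ((a - 1) / r ^+ 2 + 2 * 0) * r ^+ 2 * s ^+ 2 - 2 * 0 * r ^+ 4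
  + 2 * (b / 2) * s * rho s.

(** This is ln (F / u): with s = r p / u one has [rho s] = r q / u, so [rho s / r] is q / u and
    [s / rho s] is m. *)
Definition potential s := ln (rho s / r * h (s / rho s)).

Lemma potential_derive s : `|s| < r -> denom s != 0 /\ is_derive s (1 : R) potential (numer s /
    denom s).
Proof.
move=> sr; have rn : r != 0 by rewrite gt_eqF.
have rs0 : 0 < r ^+ 2 - s ^+ 2.
  by rewrite subr_gt0 -(real_normK (num_real s)) ltr_sqr ?nnegrE ?normr_ge0 // ltW.
have p0 : 0 < rho s by rewrite sqrtr_gt0.
have pn : rho s != 0 by rewrite gt_eqF.
have p2 : rho s ^+ 2 = r ^+ 2 - s ^+ 2 by rewrite sqr_sqrtr // ltW.
set m := s / rho s.
have sE : s = m * rho s by rewrite /m divfK.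
have r2E : r ^+ 2 = rho s ^+ 2 * (1 + m ^+ 2).
  by rewrite mulrDr mulr1 -exprMn [rho s * m]mulrC -sE p2 subrK.
have hE : h m = (h m - m * h' m) * (1 + m * (a * m + b)).
  transitivity ((h m - m * h' m) + m * h' m); first by ring.
  by have := affine m; move: (h m - m * h' m) => N ->; ring.
have q0 : 0 < 1 + m * (a * m + b).
  by have := h_gt0 m; rewrite hE pmulr_rgt0.
(* By [hE] this is rho^2 h / (h - m h'), hence positive. *)
have dE : denom s = rho s ^+ 2 * (1 + m * (a * m + b)).
  have -> : denom s = r ^+ 2 + (a - 1) * s ^+ 2 + b * s * rho s by rewrite /denom; field.
  by rewrite r2E {2 3}sE; ring.
have nE : numer s = (a - 1) * s + b * rho s by rewrite /numer; field.
have dn : denom s != 0 by rewrite dE gt_eqF // mulr_gt0 // exprn_gt0.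
split=> //.
have d1 : is_derive s (1 : R) rho (- s / rho s).
  have d : is_derive s (1 : R) (fun s => r ^+ 2 - s ^+ 2) (- (2 * s)).
    by derive_by ltac:(rewrite /=; ring).
  notypeclasses refine (drv_eq (drv_sqrt (f := fun s : R => r ^+ 2 - s ^+ 2) rs0 d) _).
  by rewrite -/(rho s); field.
have d2 : is_derive s (1 : R) (fun s => s / rho s) (r ^+ 2 / rho s ^+ 3).
  notypeclasses refine (drv_eq (drv_mul (drv_id s (1 : R)) (drv_inv _ d1)) _); first exact: pn.
  have -> : r ^+ 2 = rho s ^+ 2 + s ^+ 2 by rewrite p2 subrK.
  by cbv beta; field.
have d3 := drv_comp (f := fun s : R => s / rho s) (dh _) d2.
have d4 : is_derive s (1 : R) (fun s => rho s / r * h (s / rho s))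
    (- s / rho s / r * h m + rho s / r * (h' m * (r ^+ 2 / rho s ^+ 3))).
  notypeclasses refine (drv_eq (drv_mul (drv_mul d1 (drv_cst s (1 : R) (r^-1))) d3) _).
  by cbv beta; rewrite -/m; ring.
have v0 : 0 < rho s / r * h m by rewrite mulr_gt0 // divr_gt0.
notypeclasses refine (drv_eq (drv_comp (f := fun s : R => rho s / r * h (s / rho s))
    (is_derive1_ln v0) d4) _).
have Nn : h m - m * h' m != 0 by rewrite gt_eqF.
have h'E := affine m.
move: hE h'E Nn; set N := h m - m * h' m => hE h'E Nn.
rewrite -/m nE dE hE h'E; move: pn sE r2E; clearbody m.
move: (rho s) => p pn sE r2E; rewrite sE r2E; field.
by rewrite Nn rn pn gt_eqF.
Qed.

End Potential.

(** * The alternative over the whole domain *)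

Section Link.
Variables (R : realType) (n : nat) (Omega : set 'rV[R]_n) (F : 'rV[R]_n -> 'rV[R]_n -> R).
Variables H Hr Hm Hmm Hrm : R * R -> R.
Let A : set (R * R) := radii Omega `*` setT.
Hypotheses (n3 : (3 <= n)%N) (oO : open Omega).
Hypotheses (dHr : forall p, A p -> is_derive p ((1, 0) : R * R) H (Hr p))
  (cH : forall p, A p -> {for p, continuous H})
  (cHr : forall p, A p -> {for p, continuous Hr})
  (dHm : forall p, A p -> is_derive p ((0, 1) : R * R) H (Hm p))
  (dHmm : forall p, A p -> is_derive p ((0, 1) : R * R) Hm (Hmm p))
  (dHrm : forall p, A p -> is_derive p ((0, 1) : R * R) Hr (Hrm p)).
Hypotheses (CH : forall r k, radii Omega r -> Ck k setT (fun m => H (r, m)))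
  (CHr : forall r k, radii Omega r -> Ck k setT (fun m => Hr (r, m)))
  (CHm : forall r k, radii Omega r -> Ck k setT (fun m => Hm (r, m)))
  (CHmm : forall r k, radii Omega r -> Ck k setT (fun m => Hmm (r, m)))
  (CHrm : forall r k, radii Omega r -> Ck k setT (fun m => Hrm (r, m))).
Hypothesis FE : forall x y, Omega x -> nonradial x y ->
  F x y = pnorm (axis x) y * H (enorm x, slope (axis x) y).
Hypothesis regular : forall x y, Omega x -> nonradial x y -> 0 < F x y /\ posdef (metric_tensor F
    x y).

Let dxF x v : Omega x -> x != 0 ->
  let r := enorm x in
  {in tangential (axis x), (fun y => 'D_v (fun x => sqF F x y) x) =1
  fun y => let m := slope (axis x) y in
    pnorm (axis x) y ^+ 2 * (2 * H (r, m) * Hr (r, m)) * dot (axis x) v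
    + pnorm (axis x) y * ((2 * H (r, m) * Hm (r, m) * (1 + m ^+ 2) - 2 * m * H (r, m) ^+ 2) / r)
      * perp (axis x) y v}.
Proof.
move=> Ox x0 r y /set_mem ty /=; set m := slope (axis x) y.
pose B : set 'rV[R]_n := Omega `&` [set x | nonradial x y].
have oB : open B by apply: openI => //; exact: open_nonradial_base.
have Bx : B x by split=> //; apply/nonradialP.
have E : {in B, (fun x => sqF F x y) =1
    fun x => perp (axis x) y y * (fun p => H p ^+ 2) (enorm x, slope (axis x) y)}.
  move=> z /set_mem [Oz nz]; rewrite /sqF FE // exprMn pnorm_sqr //.
  by have /nonradialP [] := nz.
rewrite (eq_derive_on v oB E (mem_set Bx)).
have oA : open A := open_radii_plane oO.
have Am : A (r, m) by split=> //; exact: radii_enorm.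
have d1 p : A p -> is_derive p ((1, 0) : R * R) (fun p => H p ^+ 2) (2 * H p * Hr p).
  by move=> /dHr d; derive_by ltac:(rewrite /=; ring).
have d2 p : A p -> is_derive p ((0, 1) : R * R) (fun p => H p ^+ 2) (2 * H p * Hm p).
  by move=> /dHm d; derive_by ltac:(rewrite /=; ring).
have c1 p : A p -> {for p, continuous (fun p => 2 * H p * Hr p)}.
  move=> Ap; apply: (@continuousM _ _ (fun p => 2 * H p) Hr); last exact: cHr.
  by apply: (@continuousM _ _ (fun=> 2) H); [exact: cst_continuous|exact: cH].
have D := drv_energy_base oA d1 d2 c1 v x0 ty Am.
by rewrite (@derive_val _ _ _ _ _ _ _ D).
Qed.

Lemma profile_pos r m : radii Omega r ->
  [/\ 0 < H (r, m), 0 < H (r, m) - m * Hm (r, m) & 0 < Hmm (r, m)].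
Proof.
move=> [x [Ox x0 xr]]; rewrite -xr; have Rr := radii_enorm Ox x0.
have nr y : tangential (axis x) y -> nonradial x y by move=> ty; apply/nonradialP.
apply: (@fixed_radius_pos R n F x (axis x) n3 (axis_unit x0) (fun m => H (enorm x, m))
  (fun m => Hm (enorm x, m)) (fun m => Hmm (enorm x, m))).
- by move=> m'; apply/is_derive_snd/dHm.
- by move=> m'; apply/is_derive_snd/dHmm.
- by move=> y /set_mem ty; rewrite FE //; exact: nr.
- by move=> y ty; apply: regular => //; exact: nr.
Qed.

Lemma profile_dichotomy x : is_landsberg Omega F -> Omega x -> x != 0 ->
  let r := enorm x in
  (exists a c, forall m, Hr (r, m) = a * H (r, m) + c * m * Hm (r, m)) /\
  ((exists a b, forall m, Hm (r, m) = (a * m + b) * (H (r, m) - m * Hm (r, m))) \/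
   forall y, nonradial x y -> forall i j k l, berwald_curvature F i j k l x y = 0).
Proof.
move=> hL Ox x0 r; have Rr := radii_enorm Ox x0.
have nr y : tangential (axis x) y -> nonradial x y by move=> ty; apply/nonradialP.
have r0 : enorm x != 0 by rewrite gt_eqF // enorm_gt0.
have [] := @fixed_radius_dichotomy R n F x (axis x) (enorm x) n3 (axis_unit x0) r0 (fun m => H
    (r, m))
  (fun m => Hm (r, m)) (fun m => Hmm (r, m)) (fun m => Hr (r, m)) (fun m => Hrm (r, m)).
- by move=> m'; apply/is_derive_snd/dHm.
- by move=> m'; apply/is_derive_snd/dHmm.
- by move=> m'; apply/is_derive_snd/dHrm.
- by move=> k; exact: CH.
- by move=> k; exact: CHm.
- by move=> k; exact: CHmm.
- by move=> k; exact: CHr.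
- by move=> k; exact: CHrm.
- by move=> y /set_mem ty; rewrite FE //; exact: nr.
- by move=> v; exact: dxF.
- by move=> y ty; apply: regular => //; exact: nr.
- by move=> y ty; apply: hL => //; exact: nr.
- move=> pde [aff|berw]; split=> //; first by left.
  by right=> y /nonradialP [_ ty]; exact: berw.
Qed.

Lemma landsberg_alternative : is_domain Omega -> is_landsberg Omega F ->
  forall Hrmm : R * R -> R,
  (forall p, A p -> is_derive p ((0, 1) : R * R) Hrm (Hrmm p)) ->
  (forall p, A p -> is_derive p ((1, 0) : R * R) Hmm (Hrmm p)) ->
  is_berwald Omega F \/ forall r m, radii Omega r ->
    Hm (r, m) = (Hmm (r, 0) / H (r, 0) * m + Hm (r, 0) / H (r, 0)) * (H (r, m) - m * Hm (r, m)).
Proof.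
move=> hOmega hL Hrmm dHrmm dHmmr; have dich x := profile_dichotomy hL (x := x).
have H_gt0 r m : radii Omega r -> 0 < H (r, m) by move=> /(profile_pos m) [].
have Hmm_gt0 r m : radii Omega r -> 0 < Hmm (r, m) by move=> /(profile_pos m) [].
have transport r : radii Omega r ->
    exists a c, forall m, Hr (r, m) = a * H (r, m) + c * m * Hm (r, m).
  by move=> [x [Ox x0 <-]]; have [] := dich x Ox x0.
have dmm p : A p -> exists l, is_derive p ((0, 1) : R * R) Hmm l.
  case: p => r m [/= Ir _]; have d := Ck_is_derive (1 : R) (CHmm 1 Ir) (I : setT m).
  by eexists; apply/is_derive_snd; exact: d.
pose affine r := exists a b, forall m, Hm (r, m) = (a * m + b) * (H (r, m) - m * Hm (r, m)).
(* This order of cases excludes a mixture: one affine radius makes all radii affine, and if there is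
   none, every point falls under the Berwald case. *)
have [[r1 I1 aff1]|noaff] := pselect (exists2 r, radii Omega r & affine r); last first.
  left=> x y Ox nr; have [x0 _] := proj1 (nonradialP x y) nr.
  have [_ [aff|]] := dich x Ox x0; last exact.
  by case: noaff; exists (enorm x) => //; exact: radii_enorm.
right=> r m Ir; apply: (affine_coefficients dHm dHmm H_gt0 Ir).
apply: (affine_propagates (open_radii oO) _ dHr cHr dHm dHmm dHrm dHrmm dHmmr dmm
  H_gt0 Hmm_gt0 transport I1 Ir aff1) => r2 r3 t; exact: radii_interval.
Qed.

End Link.

Theorem theorem1p1 (R : realType) (n : nat) (hn : (3 <= n)%N)
    (Omega : set 'rV[R]_n) (F : 'rV[R]_n -> 'rV[R]_n -> R)
    (hOmega : is_domain Omega)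
    (hsym : spherically_symmetric Omega F)
    (hreg : almost_regular Omega F)
    (hL : is_landsberg Omega F) :
  is_berwald Omega F \/
  exists c1 c2 c3 : R -> R,
    [/\ smooth_on (radii Omega) c1, smooth_on (radii Omega) c2
      & smooth_on (radii Omega) c3] /\
    let numer (r s : R) := (c1 r + 2 * c3 r) * r ^+ 2 * s
                     + 2 * c2 r * Num.sqrt (r ^+ 2 - s ^+ 2) in
    let denom (r s : R) := r ^+ 2 + (c1 r + 2 * c3 r) * r ^+ 2 * s ^+ 2
                     - 2 * c3 r * r ^+ 4
                     + 2 * c2 r * s * Num.sqrt (r ^+ 2 - s ^+ 2) in
    exists Psi : R -> R -> R,
      (forall r s : R, radii Omega r -> `|s| < r ->
         denom r s != 0 /\ is_derive s 1 (Psi r) (numer r s / denom r s)) /\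
      (forall x y, Omega x -> nonradial x y ->
         F x y = enorm y * expR (Psi (enorm x) (dot x y / enorm y))).

Proof.
have [oO _ _] := hOmega; case: hsym => phi FE; case: hreg => smoothF regular.
pose H := profile phi.
have sH : smooth_on (radii Omega `*` setT) H := smooth_profile hn oO FE smoothF.
have FH x y : Omega x -> nonradial x y -> F x y = pnorm (axis x) y * H (enorm x, slope (axis x) y).
  exact: F_profile FE x y.
clearbody H.
pose A : set (R * R) := radii Omega `*` setT.
have oA : open A := open_radii_plane oO.
have oI := open_radii oO.
have sr := smooth_on_derive ((1, 0) : R * R) sH; have sm := smooth_on_derive ((0, 1) : R * R) sH.
have smm := smooth_on_derive ((0, 1) : R * R) sm; have srm := smooth_on_derive ((0, 1) : R * R) sr.
have srmm := smooth_on_derive ((0, 1) : R * R) srm.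
have drv G (v : R * R) : smooth_on A G -> forall p, A p -> is_derive p v G ('D_v G p).
  by move=> sG p; exact: smooth_on_is_derive.
have cont G : smooth_on A G -> forall p, A p -> {for p, continuous G}.
  by move=> sG p; exact: smooth_on_continuous.
have slice G : smooth_on A G -> forall r k, radii Omega r -> Ck k setT (fun m => G (r, m)).
  by move=> sG r k Ir; apply: Ck_slice_snd sG => //; exact: openT.
have slice0 G : smooth_on A G -> forall k, Ck k (radii Omega) (fun r => G (r, 0)).
  by move=> sG k; apply: Ck_slice_fst sG.
have rrmm p (Ap : A p) := smooth_schwarz2 oA sH Ap.
have dHm := drv _ ((0, 1) : R * R) sH; have dHr := drv _ ((1, 0) : R * R) sH.
have dHmm := drv _ ((0, 1) : R * R) sm; have dHrm := drv _ ((0, 1) : R * R) sr.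
have dHrmm := drv _ ((0, 1) : R * R) srm.
have [|aff] := landsberg_alternative hn oO dHr (cont _ sH) (cont _ sr) dHm dHmm dHrm
  (slice _ sH) (slice _ sr) (slice _ sm) (slice _ smm) (slice _ srm) FH regular hOmega hL dHrmm
      rrmm.
  by left.
right.
have [Hm [Hmm [{}aff pos dh C1 C2]]] : exists Hm Hmm : R * R -> R,
  [/\ forall r m, radii Omega r ->
        Hm (r, m) = (Hmm (r, 0) / H (r, 0) * m + Hm (r, 0) / H (r, 0)) * (H (r, m) - m * Hm (r, m)),
      forall r m, radii Omega r -> [/\ 0 < H (r, m), 0 < H (r, m) - m * Hm (r, m) & 0 < Hmm (r, m)],
      forall r, radii Omega r -> forall m, is_derive m (1 : R) (fun m => H (r, m)) (Hm (r, m)),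
      forall k, Ck k (radii Omega) (fun r => Hm (r, 0)) &
      forall k, Ck k (radii Omega) (fun r => Hmm (r, 0))].
  exists ('D_((0, 1) : R * R) H), ('D_((0, 1) : R * R) ('D_((0, 1) : R * R) H)); split.
  - exact: aff.
  - by move=> r m Ir; exact: (profile_pos hn dHm dHmm FH regular m Ir).
  - by move=> r Ir m; apply/is_derive_snd; apply: dHm.
  - exact: (slice0 _ sm).
  - exact: (slice0 _ smm).
have C0 := slice0 _ sH.
have H0 r : radii Omega r -> H (r, 0) != 0.
  by move=> /(pos r 0) [h0 _ _]; rewrite gt_eqF.
pose a r := Hmm (r, 0) / H (r, 0); pose b r := Hm (r, 0) / H (r, 0).
have Ca k : Ck k (radii Omega) a by rewrite /a; apply: (Ck_mul oI (C2 k)); exact: (Ck_inv oI H0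
    (C0 k)).
have Cb k : Ck k (radii Omega) b by rewrite /b; apply: (Ck_mul oI (C1 k)); exact: (Ck_inv oI H0
    (C0 k)).
(* For tau = a m + b the derivative of ln (F / u) in s is ((a - 1) s + b rho) / (r^2 + (a - 1) s^2 +
   b s rho), with rho = sqrt (r^2 - s^2). Matching gives (c1 + 2 c3) r^2 = a - 1 and 2 c2 = b, and
   c3 = 0 normalizes the constant term of the denominator to r^2. *)
exists (fun r => (a r - 1) / r ^+ 2), (fun r => b r / 2), (fun=> 0); split.
  split; apply: Ck_smooth_on => k.
  - apply: (Ck_mul oI); first by apply: (Ck_sub oI (Ca k)); exact: Ck_cst.
    apply: (Ck_inv oI) => [r /radii_gt0 r0|]; first by rewrite expf_eq0 /= gt_eqF.
    by apply: (Ck_exp 2 oI); exact: Ck_id.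
  - by apply: (Ck_mul oI (Cb k)); exact: Ck_cst.
  - exact: Ck_cst.
move=> numer denom; exists (fun r => potential r (fun m => H (r, m))); split=> [r s Ir|x y Ox nr].
  apply: (potential_derive (radii_gt0 Ir) (dh r Ir)) => m; last exact: aff.
    by have [] := pos r m Ir.
  by have [] := pos r m Ir.
have [x0 ty] := proj1 (nonradialP x y) nr.
rewrite FH //; set e := axis x; set q := pnorm e y; set m := slope e y; set r := enorm x.
have r0 : 0 < r by rewrite enorm_gt0.
have q0 : 0 < q := pnorm_gt0 ty.
have y0 : 0 < enorm y.
  rewrite enorm_gt0; apply/eqP => y0; move: ty.
  by rewrite /tangential /= y0 /perp !dot0r mul0r subr0 ltxx.
have h0 : 0 < H (r, m) by have [] := pos r m (radii_enorm Ox x0).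
have dE : dot x y = r * (m * q) by rewrite -dot_slope // dot_axis mulrCA divff ?mulr1 // gt_eqF.
have yE : enorm y ^+ 2 = q ^+ 2 + (m * q) ^+ 2.
  by rewrite enorm_sqr -dot_slope // /q pnorm_sqr // /perp -expr2 subrK.
have rhoE : Num.sqrt (r ^+ 2 - (dot x y / enorm y) ^+ 2) = r * q / enorm y.
  rewrite (_ : _ - _ = (r * q / enorm y) ^+ 2).
    by rewrite sqrtr_sqr ger0_norm // divr_ge0 ?mulr_ge0 // ltW.
  have -> : (r * q / enorm y) ^+ 2 = r ^+ 2 * (enorm y ^+ 2 - (m * q) ^+ 2) / enorm y ^+ 2.
    by rewrite {1}yE addrK; field; rewrite gt_eqF.
  by rewrite dE; field; rewrite gt_eqF.
have sE : dot x y / enorm y / (r * q / enorm y) = m.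
  by rewrite dE; field; rewrite !gt_eqF.
have v0 : 0 < r * q / enorm y / r * H (r, m) by rewrite mulr_gt0 // !divr_gt0 // mulr_gt0.
rewrite /potential rhoE sE lnK ?posrE //.
by field; rewrite !gt_eqF.
Qed.
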